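(* Let $\kappa$ be a successor cardinal, and suppose there is a $\kappa$-complete, $\kappa$-dense ideal on $\kappa$. Then neither of the following holds: (1) There is a weakly inaccessible cardinal $\lambda > \kappa$ and a normal, $\kappa$-complete, $\lambda^+$-saturated ideal on $[\lambda]^\kappa$. (2) There is a successor cardinal $\lambda > \kappa$ and a normal, $\kappa$-complete, $\lambda$-saturated ideal $J$ on $[\lambda]^\kappa$ such that the forcing $\mathcal{P}([\lambda]^\kappa)/J$ has uniform density $\lambda$ and preserves $\lambda^+$-saturated ideals on $\lambda$.
   Context: For an ideal $I$ on a set $Z$, $I^+ = \mathcal{P}(Z)\setminus I$ and $\mathcal{P}(Z)/I$ is the Boolean algebra of subsets of $Z$ modulo $I$ (two sets are equivalent iff their symmetric difference is in $I$); forcing with $I$ means forcing with $\mathcal{P}(Z)/I$ (with the zero element removed). For a partial order $\mathbb{P}$, $\mathrm{sat}(\mathbb{P})$ is the least cardinal $\nu$ such that every antichain has size $<\nu$, and $\mathrm{den}(\mathbb{P})$ is the least size of a dense subset. $\mathbb{P}$ is $\nu$-saturated ($\nu$-c.c.) if $\mathrm{sat}(\mathbb{P}) \le \nu$ and $\nu$-dense if $\mathrm{den}(\mathbb{P})\le\nu$; the saturation and density of an ideal $I$ are those of $\mathcal{P}(Z)/I$. $[\lambda]^\kappa = \{z\subseteq\lambda : \mathrm{ot}(z)=\kappa\}$. For $Z\subseteq \mathcal{P}(X)$, an ideal $I$ on $Z$ is normal if it is closed under diagonal unions, i.e. whenever $A_x\in I$ for all $x\in X$, then $\nabla_{x\in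 X}A_x=\{z\in Z : \exists x\in z\ (z\in A_x)\}\in I$ (equivalently, for $A \in I^+$ and $f:A\to X$ with $f(z)\in z$ for all $z$, $f$ is constant on an $I$-positive set). The forcing $\mathcal{P}([\lambda]^\kappa)/J$ has uniform density $\lambda$ if $\mathrm{den}(\mathcal{P}(A)/J)=\lambda$ for every $A\in J^+$. It preserves $\lambda^+$-saturated ideals on $\lambda$ if for every normal $\lambda^+$-saturated ideal $I$ on $\lambda$, after forcing with $\mathcal{P}([\lambda]^\kappa)/J$ the ideal generated by $I$ is still $\lambda^+$-saturated.
   Formalization: Ideals are taken to be proper and fine (for each x, the set of z not containing x is in the ideal; on κ, all bounded sets are), which the English leaves implicit; with principal or improper ideals the statement fails. *)

(* Defs.v *)
From mathcomp Require Import all_boot.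
From mathcomp Require Import boolp classical_sets functions cardinality.

Set Implicit Arguments.
Unset Strict Implicit.
Unset Printing Implicit Defensive.

Local Open Scope classical_set_scope.
Local Open Scope card_scope.

Definition card_lt T U (A : set T) (B : set U) : Prop :=
  A #<= B /\ ~ (B #<= A).

(* A cardinal is an initial ordinal: a well-ordered type all of whose proper
   initial segments have strictly smaller cardinality. *)
Record cardinal := Cardinal {
  csort :> Type;
  clt : csort -> csort -> Prop;
  clt_trans : forall x y z, clt x y -> clt y z -> clt x z;
  clt_total : forall x y, clt x y \/ x = y \/ clt y x;
  clt_wf : well_founded clt;
  clt_initial : forall x, card_lt [set y | clt y x] [set: csort] }.

Definition cardinal_lt (mu nu : cardinal) := card_lt [set: mu] [set: nu].
Definition cardinal_le (mu nu : cardinal) : Prop := [set: mu] #<= [set: nu].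

Definition is_succ_of (mu nu : cardinal) :=
  cardinal_lt mu nu /\
  forall rho : cardinal, cardinal_lt mu rho -> cardinal_le nu rho.

Definition successor_cardinal (nu : cardinal) :=
  exists mu : cardinal, infinite_set [set: mu] /\ is_succ_of mu nu.

Definition limit_cardinal (nu : cardinal) :=
  forall mu : cardinal, cardinal_lt mu nu ->
  exists rho : cardinal, cardinal_lt mu rho /\ cardinal_lt rho nu.

Definition cofinal_in (nu : cardinal) (A : set nu) :=
  forall x, exists2 y, A y & ~ clt y x.

Definition regular_cardinal (nu : cardinal) :=
  infinite_set [set: nu] /\
  forall A : set nu, cofinal_in A -> A #= [set: nu].

Definition weakly_inaccessible (nu : cardinal) :=
  ~ countable [set: nu] /\ regular_cardinal nu /\ limit_cardinal nu.

(* The set [lambda]^kappa of subsets of lambda of order type kappa. *)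
Definition has_order_type (lambda kappa : cardinal) (z : set lambda) :=
  exists f : kappa -> lambda,
    (forall a b, clt a b <-> clt (f a) (f b)) /\ range f = z.

Definition subsets_ot (lambda kappa : cardinal) : Type :=
  {z : set lambda | has_order_type kappa z}.

Definition mem_ot (lambda kappa : cardinal) (x : lambda)
  (z : subsets_ot lambda kappa) : Prop := proj1_sig z x.

Definition is_ideal Z (I : set (set Z)) :=
  [/\ I set0,
      forall A B : set Z, A `<=` B -> I B -> I A,
      forall A B : set Z, I A -> I B -> I (A `|` B)
    & ~ I setT].

Definition complete_ideal (kappa : cardinal) Z (I : set (set Z)) :=
  forall F : set (set Z), F `<=` I -> card_lt F [set: kappa] ->
  I (\bigcup_(A in F) A).

(* A family Z of subsets of X is given by its membership relation
   mem : X -> Z -> Prop. A cardinal nu is regarded as a family of subsets of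
   nu through mem := @clt nu, each ordinal being its set of predecessors; an
   ideal on nu is then fine iff it contains all bounded sets. *)
Definition fine_ideal X Z (mem : X -> Z -> Prop) (I : set (set Z)) :=
  forall x, I [set z | ~ mem x z].

Definition normal_ideal X Z (mem : X -> Z -> Prop) (I : set (set Z)) :=
  forall A : X -> set Z, (forall x, I (A x)) ->
  I [set z | exists x, mem x z /\ A x z].

(* The nonzero elements of the Boolean algebra P(A)/I, as equivalence classes
   of I-positive subsets of A. *)
Definition quot_class Z (I : set (set Z)) (A B : set Z) : set (set Z) :=
  [set C | C `<=` A /\ I (B `+` C)].

Definition quot Z (I : set (set Z)) (A : set Z) : Type :=
  {c : set (set Z) |
    exists B : set Z, [/\ B `<=` A, ~ I B & c = quot_class I A B]}.

Definition quot_le Z (I : set (set Z)) (A : set Z) (c d : quot I A) : Prop :=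
  exists B C : set Z, [/\ proj1_sig c B, proj1_sig d C & I (B `\` C)].

Section Posets.
Variables (P : Type) (le : P -> P -> Prop).

Definition compatible (p q : P) := exists r, le r p /\ le r q.

Definition antichain (A : set P) :=
  forall p q, A p -> A q -> p <> q -> ~ compatible p q.

Definition dense_subset (D : set P) := forall p, exists2 q, D q & le q p.

Definition saturated (nu : cardinal) :=
  forall A : set P, antichain A -> card_lt A [set: nu].

Definition succ_saturated (nu : cardinal) :=
  exists2 nu' : cardinal, is_succ_of nu nu' & saturated nu'.

Definition has_density (nu : cardinal) :=
  (exists2 D : set P, dense_subset D & D #= [set: nu]) /\
  forall D : set P, dense_subset D -> [set: nu] #<= D.

Definition dense_le (nu : cardinal) :=
  exists2 D : set P, dense_subset D & D #<= [set: nu].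

End Posets.

Definition uniform_density Z (J : set (set Z)) (nu : cardinal) :=
  forall A : set Z, ~ J A -> has_density (@quot_le Z J A) nu.

(* Formulas of the language of set theory, with parameters and bound variables
   ranging over V. *)
Inductive formula (V : Type) : Type :=
| FMem of V & V
| FEq of V & V
| FNot of formula V
| FAnd of formula V & formula V
| FAll of (V -> formula V).

Section Formulas.
Variable V : Type.
Implicit Types (phi psi : formula V) (f x y z a b : V).

Definition FImp phi psi := FNot (FAnd phi (FNot psi)).
Definition FIff phi psi := FAnd (FImp phi psi) (FImp psi phi).
Definition FOr phi psi := FNot (FAnd (FNot phi) (FNot psi)).
Definition FEx (F : V -> formula V) := FNot (FAll (fun x => FNot (F x))).
Definition FAllIn a (F : V -> formula V) :=
  FAll (fun x => FImp (FMem x a) (F x)).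
Definition FExIn a (F : V -> formula V) :=
  FEx (fun x => FAnd (FMem x a) (F x)).

Definition FSub x y := FAllIn x (fun z => FMem z y).

Definition FIsInter z x y :=
  FAll (fun t => FIff (FMem t z) (FAnd (FMem t x) (FMem t y))).

Definition FIsUPair z x y :=
  FAll (fun t => FIff (FMem t z) (FOr (FEq t x) (FEq t y))).

Definition FIsPair z x y :=
  FEx (fun s => FEx (fun t =>
    FAnd (FIsUPair s x x) (FAnd (FIsUPair t x y) (FIsUPair z s t)))).

Definition FPairIn x y f := FExIn f (fun z => FIsPair z x y).

Definition FInjection f a b :=
  FAnd (FAllIn f (fun z => FExIn a (fun x => FExIn b (fun y => FIsPair z x y))))
 (FAnd (FAllIn a (fun x => FExIn b (fun y => FPairIn x y f)))
 (FAnd (FAllIn a (fun x => FAllIn b (fun y => FAllIn b (fun z =>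
          FImp (FAnd (FPairIn x y f) (FPairIn x z f)) (FEq y z)))))
       (FAllIn a (fun x => FAllIn a (fun y => FAllIn b (fun z =>
          FImp (FAnd (FPairIn x z f) (FPairIn y z f)) (FEq x y))))))).

Definition FCardLe a b := FEx (fun f => FInjection f a b).

(* x belongs to the ideal on lam generated by I, when I is already closed
   under finite unions. *)
Definition FInGenIdeal (lam I x : V) :=
  FAnd (FSub x lam) (FExIn I (fun y => FSub x y)).

(* A set of representatives of an antichain of P(lam)/(generated ideal): two
   classes are incompatible iff the intersection is in the ideal. *)
Definition FAntichainModGen (lam I A : V) :=
  FAnd (FAllIn A (fun x => FAnd (FSub x lam) (FNot (FInGenIdeal lam I x))))
       (FAllIn A (fun x => FAllIn A (fun y => FImp (FNot (FEq x y))
          (FAll (fun z => FImp (FIsInter z x y) (FInGenIdeal lam I z)))))).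

(* The ideal generated by I is lam^+-saturated, where "size < lam^+" is
   expressed as "size <= lam". *)
Definition FGenIdealSuccSaturated (lam I : V) :=
  FAll (fun A => FImp (FAntichainModGen lam I A) (FCardLe A lam)).

End Formulas.

Section Forcing.
Variables (P : Type) (le : P -> P -> Prop).

(* P-names: Name A f c stands for the set of pairs (f i, c i), i : A. *)
Inductive name : Type := Name (A : Type) (f : A -> name) (c : A -> P).

Fixpoint forces_eq (p : P) (s t : name) {struct s} : Prop :=
  match s, t with
  | Name A f c, Name B g d =>
    (forall (i : A) (q : P), le q p -> le q (c i) ->
      exists r, le r q /\ exists j : B, le r (d j) /\ forces_eq r (f i) (g j))
    /\
    (forall (j : B) (q : P), le q p -> le q (d j) ->
      exists r, le r q /\ exists i : A, le r (c i) /\ forces_eq r (f i) (g j))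
  end.

Definition forces_mem (p : P) (s t : name) : Prop :=
  match t with
  | Name B g d =>
    forall q, le q p ->
      exists r, le r q /\ exists j : B, le r (d j) /\ forces_eq r s (g j)
  end.

Fixpoint forces (p : P) (phi : formula name) {struct phi} : Prop :=
  match phi with
  | FMem s t => forces_mem p s t
  | FEq s t => forces_eq p s t
  | FNot psi => forall q, le q p -> ~ forces q psi
  | FAnd psi chi => forces p psi /\ forces p chi
  | FAll F => forall s : name, forces p (F s)
  end.

Definition forced (phi : formula name) := forall p, forces p phi.

(* The canonical name of {f i | i : A}; attaching every condition to each
   element is equivalent to attaching the largest one. *)
Definition check_family (A : Type) (f : A -> name) : name :=
  Name (fun ip : A * P => f ip.1) (fun ip => ip.2).

Section Check.
Variable nu : cardinal.

Definition check_ordinal : nu -> name :=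
  Fix (@clt_wf nu) (fun _ => name)
    (fun x rec => check_family
       (fun y : {y : nu | clt y x} => rec (proj1_sig y) (proj2_sig y))).

Definition check_set (A : set nu) : name :=
  check_family (fun x : {x : nu | A x} => check_ordinal (proj1_sig x)).

Definition check_set_of_sets (I : set (set nu)) : name :=
  check_family (fun A : {A : set nu | I A} => check_set (proj1_sig A)).

End Check.

Definition preserves_succ_saturated_ideals (nu : cardinal) :=
  forall I : set (set nu),
    is_ideal I -> fine_ideal (@clt nu) I -> normal_ideal (@clt nu) I ->
    succ_saturated (@quot_le nu I setT) nu ->
    forced (FGenIdealSuccSaturated (check_set [set: nu]) (check_set_of_sets I)).

End Forcing.

(* Main.v *)
(** Write kappa = mu^+ and let f_z enumerate z in [lambda]^kappa in order. The
   kappa-dense ideal can be projected to a normal one, I, along a minimal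
   unbounded function. Generic ultrapowers are replaced by the ideal L of those
   S included in lambda x Z such that, for J-almost all z, the pullback along f_z
   of the section of S at z is in I. Normality of J turns a dense family of size
   kappa for I into one showing that L inherits the saturation of J, and its
   density.

   (1) If lambda is a limit cardinal, there are lambda^+ eventually different
   functions below one h : lambda -> lambda. For almost all z and x in z they
   take at most mu values at x, so lambda^+ of them agree with the same one of
   mu choices on L-positive sets, and these sets form an antichain.

   (2) Let T be the trace of L on lambda, a normal lambda^+-saturated ideal, and
   K the product of T and J, which is included in L. Preservation makes K
   lambda^+-saturated, whence L is the restriction of K to some set, which
   therefore has density lambda modulo K. Diagonalizing against a dense family of
   size lambda contradicts the uniform density of J. *)

Require Import Defs.
From mathcomp Require Import all_boot.
From mathcomp Require Import boolp classical_sets functions cardinality wochoice.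

Set Implicit Arguments.
Unset Strict Implicit.
Unset Printing Implicit Defensive.

Local Open Scope classical_set_scope.
Local Open Scope card_scope.

(** * Cardinal arithmetic *)

Lemma inj_on_card_le T U (A : set T) (B : set U) (f : T -> U) :
  (forall x, A x -> B (f x)) ->
  (forall x y, A x -> A y -> f x = f y -> x = y) -> A #<= B.
Proof.
move=> fAB finj.
have fi : {in A &, injective f}.
  by move=> x y; rewrite !inE => Ax Ay; exact: finj.
have := inj_card_eq fi; rewrite card_eq_le => /andP[_ AfA].
apply: (card_le_trans AfA); apply: subset_card_le => _ [x Ax <-]; exact: fAB.
Qed.

Lemma card_le_inj_on T U (A : set T) (B : set U) (u0 : U) : A #<= B ->
  exists f : T -> U, (forall x, A x -> B (f x)) /\
    (forall x y, A x -> A y -> f x = f y -> x = y).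
Proof.
move=> /card_leP[f].
pose g x := if pselect (A x) is left Ax then val (f (SigSub (mem_set Ax))) else u0.
have gE x (Ax : A x) : g x = val (f (SigSub (mem_set Ax))).
  rewrite /g; case: pselect => // Ax'; congr (val (f _)); exact: val_inj.
exists g; split=> [x Ax|x y Ax Ay].
  rewrite gE; exact: set_valP.
rewrite !gE => /val_inj /inj fE; have := fE (in_setT _) (in_setT _).
by move=> /(congr1 val).
Qed.

Lemma card_le_neq0_inj_on T U (A : set T) (B : set U) : A !=set0 -> A #<= B ->
  exists f : T -> U, (forall x, A x -> B (f x)) /\
    (forall x y, A x -> A y -> f x = f y -> x = y).
Proof.
move=> A0 AB; have [/eqP B0|/set0P[u _]] := boolP (B == set0).
  by move: AB A0; rewrite B0 card_le0 => /eqP-> [].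
exact: card_le_inj_on.
Qed.

Lemma surj_on_card_le T U (A : set T) (B : set U) (f : T -> U) :
  (forall y, B y -> exists2 x, A x & f x = y) -> B #<= A.
Proof.
move=> fsurj; apply: card_le_trans (card_image_le f A).
by apply: subset_card_le => y /fsurj[x Ax <-]; exists x.
Qed.

Lemma card_le_surj T U (B : set U) (u0 : U) : B #<= [set: T] ->
  exists f : T -> U, forall y, B y -> exists x, f x = y.
Proof.
have [[t0 _]|T0] := pselect (exists t : T, True); last first.
  move=> BT; exists (fun=> u0) => y By; case: T0.
  have B0 : B !=set0 by exists y.
  have [g _] := card_le_neq0_inj_on B0 BT.
  by exists (g y).
move=> /(card_le_inj_on t0)[g [_ ginj]].
pose f t := if pselect (exists2 y, B y & g y = t) is left p
            then projT1 (cid2 p) else u0.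
exists f => y By; exists (g y); rewrite /f; case: pselect => [p|]; last first.
  by case; exists y.
by case: cid2 => y' By' /= /ginj ->.
Qed.

Lemma card_leX T U T' U' (A : set T) (B : set U) (A' : set T') (B' : set U') :
  A #<= A' -> B #<= B' -> A `*` B #<= A' `*` B'.
Proof.
move=> AA' BB'; have [->|/set0P[[a b] [Aa Bb]]] := eqVneq (A `*` B) set0.
  exact: card_ge0.
have A0 : A !=set0 by exists a.
have B0 : B !=set0 by exists b.
have [f [fA finj]] := card_le_neq0_inj_on A0 AA'.
have [g [gB ginj]] := card_le_neq0_inj_on B0 BB'.
apply: (inj_on_card_le (f := fun p => (f p.1, g p.2))).
  by move=> [x y] [/= Ax By]; split; [exact: fA|exact: gB].
move=> [x y] [x' y'] [/= Ax By] [/= Ax' By'] [/finj-> // /ginj-> //].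
Qed.

(** Hilbert's hotel: when [x] is new, it goes to [e 0] and [e n] to [e n.+1], for an injection [e]
    of the natural numbers into [A]; all other points stay. *)
Lemma infinite_setU1_le T (A : set T) (x : T) :
  infinite_set A -> x |` A #<= A.
Proof.
move=> /infiniteP /(card_le_inj_on x)[e [eA einj]].
have [Ax|nAx] := pselect (A x).
  by apply: subset_card_le => y [->|].
pose f y := if pselect (y = x) then e 0
  else if pselect (exists n, e n = y) is left p then e (projT1 (cid p)).+1 else y.
have ex n : e n <> x by move=> enx; apply: nAx; rewrite -enx; exact: eA.
have fx : f x = e 0 by rewrite /f; case: pselect.
have fe n : f (e n) = e n.+1.
  rewrite /f; case: (pselect (e n = x)) => [enx|nx] /=; first by case: (ex n).
  case: (pselect (exists m, e m = e n)) => [p|]; last by case; exists n.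
  by case: cid => m /= /einj -> .
have fid y : y <> x -> (forall n, e n <> y) -> f y = y.
  move=> yx ye; rewrite /f; case: (pselect (y = x)) => // nx /=.
  case: (pselect (exists n, e n = y)) => // p; by case: (p) => n en; case: (ye n).
apply: (inj_on_card_le (f := f)) => [y [->|Ay]|y z yA zA].
- by rewrite fx; exact: eA.
- have yx : y <> x by move=> yx; rewrite yx in Ay.
  have [[n <-]|/forallNP ny] := pselect (exists n, e n = y).
    by rewrite fe; exact: eA.
  by rewrite fid.
have H w : [\/ w = x, exists n, w = e n | w <> x /\ forall n, e n <> w].
  have [->|wx] := pselect (w = x); first by constructor 1.
  have [[n <-]|/forallNP nw] := pselect (exists n, e n = w).
    by constructor 2; exists n.
  by constructor 3.
case: (H y) => [->|[n ->]|[yx ye]]; case: (H z) => [->|[m ->]|[zx ze]] //;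
  rewrite ?fx ?fe ?fid //.
- by move=> /einj e0; case: (e0 Logic.I Logic.I).
- by move=> /ze.
- by move=> /einj e0; case: (e0 Logic.I Logic.I).
- by move=> /einj enm; have [->] := enm Logic.I Logic.I.
- by move=> /ze.
- by move=> /esym /ye.
- by move=> /esym /ye.
Qed.

(** * Well-orders and comparability of cardinals *)

Record wo T (lt : T -> T -> Prop) : Prop := Wo {
  wo_trans : forall x y z, lt x y -> lt y z -> lt x z;
  wo_total : forall x y, lt x y \/ x = y \/ lt y x;
  wo_wf : well_founded lt }.

Definition seg T (lt : T -> T -> Prop) (x : T) : set T := [set y | lt y x].

Section WellOrder.
Variables (T : Type) (lt : T -> T -> Prop) (ltwo : wo lt).

Lemma wo_irr x : ~ lt x x.
Proof. by elim/(well_founded_ind (wo_wf ltwo)): x => x IH xx; exact: IH (xx) (xx). Qed.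

Lemma wo_nlt x y : lt x y -> ~ lt y x.
Proof. by move=> xy yx; exact: wo_irr (wo_trans ltwo xy yx). Qed.

Lemma wo_min (A : set T) : A !=set0 -> exists2 x, A x & forall y, A y -> ~ lt y x.
Proof.
move=> [x]; elim/(well_founded_ind (wo_wf ltwo)): x => x IH Ax.
have [[y [Ay yx]]|nA] := pselect (exists y, A y /\ lt y x); first exact: IH Ay.
by exists x => // y Ay yx; apply: nA; exists y.
Qed.

Lemma wo_subset (A : set T) : wo (fun x y : {x | A x} => lt (proj1_sig x) (proj1_sig y)).
Proof.
split=> [x y z|x y|].
- exact: (wo_trans ltwo).
- have [|[|]] := wo_total ltwo (proj1_sig x) (proj1_sig y); [by left| |by right; right].
  by case: x y => [x Ax] [y Ay] /= e; right; left; exact: eq_exist.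
- move=> [x]; elim/(well_founded_ind (wo_wf ltwo)): x => x IH Ax.
  by constructor => -[y Ay] /= yx; exact: IH.
Qed.

End WellOrder.

(** The strict part of a reflexive well-order is taken. Transitivity is read off the least element
    of [{x, y, z}]. *)
Lemma wo_exists T : exists lt : T -> T -> Prop, wo lt.
Proof.
have [R Rwo] := @well_ordering_principle {classic T}.
have Rch : wo_chain R predT by move=> C _; exact: Rwo.
have Rtot := wo_chainW Rch.
have Ranti := wo_chain_antisymmetric Rch.
have Rmin (A : set T) x : A x -> exists2 z, A z & forall y, A y -> R z y.
  move=> Ax; have [|z [[Az zA] _]] := Rwo [pred x | `[< A x >]].
    by exists x; apply/asboolP.
  by exists z => [|y Ay]; [exact/asboolP|apply: zA; exact/asboolP].
exists (fun x y => R x y /\ x <> y); split.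
- move=> x y z [xy nxy] [yz nyz].
  have [|w Aw wmin] := Rmin [set x; y; z] x; first by left; left.
  have xz : R x z.
    case: Aw => [[|]|] /= e; rewrite {}e in wmin.
    + by apply: wmin; right.
    + case: nxy; apply: Ranti => //; rewrite xy wmin //; by left; left.
    + case: nyz; apply: Ranti => //; rewrite yz wmin //; by left; right.
  split=> // e; case: nxy; apply: Ranti => //; rewrite xy /=; by rewrite e.
- move=> x y; have [->|xy] := pselect (x = y); first by right; left.
  have /orP[?|?] : R x y || R y x by exact: Rtot.
    by left.
  by right; right; split=> // /esym.
- move=> x; apply: contrapT => nx.
  have [z nz zmin] := Rmin [set x | ~ Acc (fun x y => R x y /\ x <> y) x] x nx.
  apply: nz; constructor => y [yz nyz]; apply: contrapT => /zmin zy.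
  by apply: nyz; apply: Ranti => //; rewrite yz.
Qed.

(** By recursion, [f x] is the least element of [U] not taken before [x]. If some stage finds none,
    [f] is already onto; otherwise [f] is injective with a range closed downwards, which is all of
    [U] or lies below some [u]. *)
Lemma wo_compare T U (ltT : T -> T -> Prop) (ltU : U -> U -> Prop) :
  wo ltT -> wo ltU ->
  (exists u, [set: T] #<= seg ltU u) \/ [set: U] #<= [set: T].
Proof.
move=> woT woU.
have [[u0 _]|U0] := pselect (exists u : U, True); last first.
  right; suff -> : [set: U] = set0 by exact: card_ge0.
  by apply/seteqP; split=> // u _; apply: U0; exists u.
pose next (A : set U) := if pselect (A !=set0) is left p
  then projT1 (cid2 (wo_min woU p)) else u0.
have nextP A : A !=set0 -> A (next A) /\ forall y, A y -> ~ ltU y (next A).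
  by rewrite /next; case: pselect => // p _; case: cid2.
pose f := Fix (wo_wf woT) (fun=> U) (fun x rec =>
  next [set u | forall y (yx : ltT y x), rec y yx <> u]).
have fE x : f x = next [set u | forall y, ltT y x -> f y <> u].
  rewrite /f Fix_eq // => {}x g h gh; congr next; apply/seteqP.
  by split=> u /= H y yx; rewrite (gh, =^~ gh); exact: H.
have [fall|/existsNP[x nx]] := pselect (forall x, [set u | forall y, ltT y x -> f y <> u] !=set0).
  have f1 x y : ltT y x -> f y <> f x.
    by move=> yx; have [fx _] := nextP _ (fall x); rewrite [f x]fE; exact: fx.
  have f2 x u : ltU u (f x) -> exists2 y, ltT y x & f y = u.
    move=> ufx; have [_ fx] := nextP _ (fall x).
    rewrite fE in ufx; apply: contrapT => nex; apply: fx ufx => y yx fyu.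
    by apply: nex; exists y.
  have finj x y : f x = f y -> x = y.
    by case: (wo_total woT x y) => [/f1|[//|/f1/nesym]].
  have [fs|/existsNP[u nu]] := pselect (forall u, exists x, f x = u).
    by right; apply: (@surj_on_card_le _ _ _ _ f) => u _; have [x] := fs u; exists x.
  left; exists u; apply: (@inj_on_card_le _ _ _ _ f) => [x _|x y _ _]; last exact: finj.
  case: (wo_total woU (f x) u) => [//|[e|]]; first by case: nu; exists x.
  by move=> /f2[y _ fy]; case: nu; exists y.
right; apply: (@surj_on_card_le _ _ _ _ f) => u _.
have [[y]|/forallNP H] := pselect (exists y, f y = u); first by exists y.
by case: nx; exists u => y _; exact: H.
Qed.

Lemma wo_card (nu : cardinal) : wo (@clt nu).
Proof. by split; [exact: clt_trans|exact: clt_total|exact: clt_wf]. Qed.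

Lemma card_compare T (nu : cardinal) :
  (exists u : nu, [set: T] #<= seg (@clt nu) u) \/ [set: nu] #<= [set: T].
Proof. by have [lt ltwo] := wo_exists T; exact: wo_compare ltwo (wo_card nu). Qed.

Lemma seg_lt (nu : cardinal) (x : nu) : ~ ([set: nu] #<= seg (@clt nu) x).
Proof. by case: (clt_initial x). Qed.

Lemma sub_sig_card_eq T (A B : set T) : B `<=` A ->
  [set x : {x | A x} | B (proj1_sig x)] #= B.
Proof.
move=> BA; rewrite card_eq_le; apply/andP; split.
  apply: (@inj_on_card_le _ _ _ _ (@proj1_sig _ _)) => [//|].
  by move=> [x Ax] [y Ay] _ _ /= e; exact: eq_exist.
apply: (@surj_on_card_le _ _ _ _ (@proj1_sig T A)) => y By.
by exists (exist A y (BA _ By)).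
Qed.

Lemma sig_card_eq T (A : set T) : [set: {x | A x}] #= A.
Proof.
have := @sub_sig_card_eq T A A (fun=> id).
by congr (_ #= _); apply/seteqP; split=> // -[].
Qed.

Lemma seg_sub_sig T (lt : T -> T -> Prop) (x : T) (y : {y | seg lt x y}) : wo lt ->
  seg (fun a b : {y | seg lt x y} => lt (proj1_sig a) (proj1_sig b)) y
    #= seg lt (proj1_sig y).
Proof.
move=> ltwo; apply: (@sub_sig_card_eq T (seg lt x) (seg lt (proj1_sig y))) => z zy.
exact: (wo_trans ltwo zy (proj2_sig y)).
Qed.

(** A well-order of [T] is cut at the first point whose segment no longer embeds into [U], if there
    is one. What remains does not embed into [U] while its proper segments do, so it is an initial
    ordinal. *)
Lemma cardinal_above T U : ~ ([set: T] #<= [set: U]) ->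
  exists rho : cardinal, [/\ [set: rho] #<= [set: T], ~ ([set: rho] #<= [set: U])
    & forall x : rho, seg (@clt rho) x #<= [set: U]].
Proof.
move=> nTU; have [lt ltwo] := wo_exists T.
have mk S (l : S -> S -> Prop) : wo l -> [set: S] #<= [set: T] ->
    ~ ([set: S] #<= [set: U]) -> (forall x, seg l x #<= [set: U]) ->
  exists rho : cardinal, [/\ [set: rho] #<= [set: T], ~ ([set: rho] #<= [set: U])
    & forall x : rho, seg (@clt rho) x #<= [set: U]].
  move=> [tr tot wf] ST nSU lU.
  have ini x : card_lt [set y | l y x] [set: S].
    by split; [exact: card_leT|move=> /card_le_trans/(_ (lU x))].
  by exists (Cardinal tr tot wf ini).
have [all_le|/existsNP[x0 nx0]] := pselect (forall x, seg lt x #<= [set: U]).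
  by apply: (mk T lt) => //; exact: card_lexx.
have [|x nx xmin] := wo_min ltwo (A := [set x | ~ (seg lt x #<= [set: U])]).
  by exists x0.
apply: (mk _ _ (wo_subset ltwo (seg lt x))).
- by rewrite (card_le_eql (sig_card_eq _)); exact: card_leT.
- by rewrite (card_le_eql (sig_card_eq _)).
- move=> y; rewrite (card_le_eql (seg_sub_sig y ltwo)).
  by apply: contrapT => /xmin; apply; exact: (proj2_sig y).
Qed.

Lemma cardinal_of T : exists rho : cardinal, [set: rho] #= [set: T].
Proof.
have [lt ltwo] := wo_exists T.
have mk S (l : S -> S -> Prop) : wo l -> [set: S] #= [set: T] ->
    (forall x, ~ ([set: S] #<= seg l x)) -> exists rho : cardinal, [set: rho] #= [set: T].
  move=> [tr tot wf] ST nS.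
  have ini x : card_lt [set y | l y x] [set: S].
    by split; [exact: card_leT|exact: nS].
  by exists (Cardinal tr tot wf ini).
have [[x0 Tx0]|/forallNP nT] := pselect (exists x, [set: T] #<= seg lt x); last exact: (mk T lt).
have [|x Tx xmin] := wo_min ltwo (A := [set x | [set: T] #<= seg lt x]).
  by exists x0.
apply: (mk _ _ (wo_subset ltwo (seg lt x))).
  rewrite (card_eql (sig_card_eq _)) card_eq_le Tx andbT; exact: card_leT.
move=> y; rewrite (card_le_eql (sig_card_eq _)) (card_le_eqr (seg_sub_sig y ltwo)).
move=> /(card_le_trans Tx)/xmin; apply; exact: (proj2_sig y).
Qed.

Lemma card_le_total (mu : cardinal) T : ~ ([set: T] #<= [set: mu]) ->
  [set: mu] #<= [set: T].
Proof.
move=> nT; have [[x /card_le_trans Tx]|//] := card_compare T mu.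
by case: nT; apply: Tx; exact: card_leT.
Qed.

(** Cantor's diagonal argument provides a type larger than [lambda]; [cardinal_above] then finds the
    first cardinal beyond [lambda]. *)
Lemma succ_exists (lambda : cardinal) : exists nu, is_succ_of lambda nu.
Proof.
have nle : ~ ([set: set lambda] #<= [set: lambda]).
  move=> /(card_le_surj set0)[f fs].
  have [x fx] := fs [set x | ~ f x x] Logic.I.
  have [a b] : f x x <-> ~ f x x by rewrite {1}fx.
  have np : ~ f x x by move=> p; exact: (a p p).
  exact: np (b np).
have [rho [_ nrho le_seg]] := cardinal_above nle.
exists rho; split=> [|sigma [_ nsigma]]; first by split=> //; exact: card_le_total.
have [[x /card_le_trans sx]|//] := card_compare sigma rho.
by case: nsigma; exact: sx.
Qed.

(** Otherwise [cardinal_above] finds a cardinal inside [A] that exceeds [mu], and [kappa] embeds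
    into it. *)
Lemma lt_succ_le (mu kappa : cardinal) T (A : set T) : is_succ_of mu kappa ->
  ~ ([set: kappa] #<= A) -> A #<= [set: mu].
Proof.
move=> [_ kmin] nkA; apply: contrapT => nA.
have := @cardinal_above {x | A x} mu; rewrite (card_le_eql (sig_card_eq _)).
move=> /(_ nA)[rho []]; rewrite (card_le_eqr (sig_card_eq _)) => rhoA nrho _.
apply: nkA; apply: card_le_trans rhoA; apply: kmin; split=> //.
exact: card_le_total.
Qed.

(** * Squares of infinite cardinals *)

Section Square.
Variables (T : Type) (lt : T -> T -> Prop) (ltwo : wo lt).

Let mx (p : T * T) := if pselect (lt p.1 p.2) then p.2 else p.1.

Let mx_ge p : ~ lt (mx p) p.1 /\ ~ lt (mx p) p.2.
Proof.
rewrite /mx; case: (pselect (lt p.1 p.2)) => /= h; split=> //.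
- exact: wo_nlt.
- exact: wo_irr.
- exact: wo_irr.
Qed.

(** Goedel's canonical order of pairs: by maximum, then lexicographically. *)
Let glt (p q : T * T) := lt (mx p) (mx q) \/
  mx p = mx q /\ (lt p.1 q.1 \/ p.1 = q.1 /\ lt p.2 q.2).

Let glt_wo : wo glt.
Proof.
have tr := wo_trans ltwo.
split.
- move=> x y z [xy|[xy1 [xy2|[xy2 xy3]]]] [yz|[yz1 [yz2|[yz2 yz3]]]].
  + by left; exact: tr xy yz.
  + by left; rewrite -yz1.
  + by left; rewrite -yz1.
  + by left; rewrite xy1.
  + by right; rewrite xy1; split=> //; left; exact: tr xy2 yz2.
  + by right; rewrite xy1 -yz2; split=> //; left.
  + by left; rewrite xy1.
  + by right; rewrite xy1 xy2; split=> //; left.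
  + by right; rewrite xy1 xy2; split=> //; right; split=> //; exact: tr xy3 yz3.
- move=> x y; case: (wo_total ltwo (mx x) (mx y)) => [h|[h|h]].
  + by left; left.
  + case: (wo_total ltwo x.1 y.1) => [h1|[h1|h1]].
    * by left; right; split=> //; left.
    * case: (wo_total ltwo x.2 y.2) => [h2|[h2|h2]].
      - by left; right; split=> //; right.
      - by right; left; case: x y {h} h1 h2 => [? ?] [? ?] /= -> ->.
      - by right; right; right; split=> //; right.
    * by right; right; right; split=> //; left.
  + by right; right; left.
- have H m : forall p, mx p = m -> Acc glt p.
    elim/(well_founded_ind (wo_wf ltwo)): m => m IHm.
    have H a : forall p, mx p = m -> p.1 = a -> Acc glt p.
      elim/(well_founded_ind (wo_wf ltwo)): a => a IHa.
      have H b : forall p, mx p = m -> p.1 = a -> p.2 = b -> Acc glt p.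
        elim/(well_founded_ind (wo_wf ltwo)): b => b IHb p pm pa pb.
        constructor => q [qm|[qm [qa|[qa qb]]]].
        + by apply: (IHm (mx q)) => //; rewrite -pm.
        + by apply: (IHa q.1) => //; rewrite -?pa // qm.
        + by apply: (IHb q.2) => //; rewrite -?pb // ?qm // qa.
      by move=> p pm pa; exact: (H p.2).
    by move=> p pm; exact: (H p.1).
  by move=> p; exact: (H (mx p)).
Qed.

(** A proper segment of the canonical order lies in the square of a segment of [T] with one point
    added. That square is smaller than [T], so comparability leaves only the embedding of [T * T]
    into [T]. *)
Lemma initial_wo_square : infinite_set [set: T] ->
  (forall m, ~ ([set: T] #<= seg lt m)) ->
  (forall m, infinite_set (seg lt m) -> seg lt m `*` seg lt m #<= seg lt m) ->
  [set: T * T] #<= [set: T].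
Proof.
move=> Tinf ini sq; have [[q Tq]|//] := wo_compare ltwo glt_wo.
pose m := mx q; pose S := m |` seg lt m.
have qS : seg glt q `<=` S `*` S.
  move=> p pq; have [p1 p2] := mx_ge p.
  have xS x : ~ lt (mx p) x -> S x.
    move=> px; case: (wo_total ltwo x m) => [|[->|mx']]; [by right|by left|].
    case: px; case: pq => [|[->]//] pq.
    exact: (wo_trans ltwo pq mx').
  by split; exact: xS.
have {}Tq := card_le_trans Tq (subset_card_le qS).
have [fin|inf] := pselect (finite_set (seg lt m)).
  case: Tinf; apply: card_le_finite Tq _; apply: finite_setX;
    by rewrite finite_setU; split=> //; exact: finite_set1.
case: (ini m); apply: card_le_trans Tq _.
apply: card_le_trans (sq _ inf).
by apply: card_leX; exact: infinite_setU1_le.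
Qed.

End Square.

(** By induction, either a shorter segment of the same size settles the claim, or the segment is an
    initial ordinal and [initial_wo_square] applies to it. *)
Lemma seg_square T (lt : T -> T -> Prop) : wo lt -> forall x,
  infinite_set (seg lt x) -> seg lt x `*` seg lt x #<= seg lt x.
Proof.
move=> ltwo; elim/(well_founded_ind (wo_wf ltwo)) => x IH xinf.
have [[y [yx xy]]|ini] := pselect (exists y, lt y x /\ seg lt x #<= seg lt y).
  have yinf : infinite_set (seg lt y) by move=> yfin; apply: xinf; exact: card_le_finite xy yfin.
  apply: card_le_trans (card_leX xy xy) _; apply: card_le_trans (IH y yx yinf) _.
  by apply: subset_card_le => z zy; exact: (wo_trans ltwo zy yx).
have E := sig_card_eq (seg lt x).
have := initial_wo_square (wo_subset ltwo (seg lt x)).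
rewrite -setXTT => H.
have [_] := andP (etrans (esym (card_eq_le _ _)) E) => xT.
apply: card_le_trans (card_leX xT xT) _.
rewrite -(card_le_eqr E); apply: H.
- by move=> fin; apply: xinf; exact: card_le_finite xT fin.
- move=> m; rewrite (card_le_eql E) (card_le_eqr (seg_sub_sig m ltwo)) => xm.
  by apply: ini; exists (proj1_sig m); split=> //; exact: (proj2_sig m).
- move=> m minf.
  have F := seg_sub_sig m ltwo.
  have [Fl Fr] := andP (etrans (esym (card_eq_le _ _)) F).
  apply: card_le_trans (card_leX Fl Fl) _; apply: card_le_trans Fr.
  apply: IH; first exact: (proj2_sig m).
  by move=> fin; apply: minf; exact: card_le_finite Fl fin.
Qed.

Lemma cardinal_square (nu : cardinal) : infinite_set [set: nu] ->
  [set: nu * nu] #<= [set: nu].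
Proof.
move=> nuinf; apply: (initial_wo_square (wo_card nu)) => //.
  by move=> m; exact: seg_lt.
exact: seg_square (wo_card nu).
Qed.

Lemma card_le_sum (nu : cardinal) T U (A : set T) (f : T -> U) :
  infinite_set [set: nu] -> f @` A #<= [set: nu] ->
  (forall u, A `&` f @^-1` [set u] #<= [set: nu]) -> A #<= [set: nu].
Proof.
move=> nuinf fA fib; apply: card_le_trans (cardinal_square nuinf).
have [x0 _] := infinite_setN0 nuinf.
have [g [_ ginj]] := card_le_inj_on x0 fA.
have /choice[h hP] u := card_le_inj_on x0 (fib u).
apply: (@inj_on_card_le _ _ _ _ (fun x => (g (f x), h (f x) x))) => // x y Ax Ay [].
move=> /ginj fxy; have {}fxy : f x = f y by apply: fxy; [exists x|exists y].
by rewrite fxy; case: (hP (f y)) => _ hinj /hinj; apply.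
Qed.

Lemma infinite_cardinal_nomax (nu : cardinal) (x : nu) : infinite_set [set: nu] ->
  exists y, clt x y.
Proof.
move=> nuinf; apply: contrapT => /forallNP nx.
have H : [set: nu] `<=` x |` seg (@clt nu) x.
  by move=> y _; case: (clt_total x y) => [/nx//|[->|]]; [left|right].
have xinf : infinite_set (seg (@clt nu) x).
  move=> fin; apply: nuinf; apply: sub_finite_set H _.
  by rewrite finite_setU; split=> //; exact: finite_set1.
apply: (@seg_lt nu x); apply: card_le_trans (subset_card_le H) _.
exact: infinite_setU1_le.
Qed.

(** * Ideals and their quotients *)

Section Ideal.
Variables (Z : Type) (I : set (set Z)) (hI : is_ideal I).

Lemma idealS A B : A `<=` B -> I B -> I A.
Proof. by case: hI => _ H _ _; exact: H. Qed.

Lemma idealU A B : I A -> I B -> I (A `|` B).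
Proof. by case: hI => _ _ H _; exact: H. Qed.

Lemma ideal0 : I set0.
Proof. by case: hI. Qed.

Lemma idealT : ~ I setT.
Proof. by case: hI. Qed.

Lemma ideal_cover A B C : I A -> I B -> C `<=` A `|` B -> I C.
Proof. by move=> IA IB /idealS; apply; exact: idealU. Qed.

Lemma positive_cover A B C : ~ I C -> I A -> C `<=` A `|` B -> ~ I B.
Proof. by move=> IC IA CAB IB; apply: IC; exact: ideal_cover IA IB CAB. Qed.

Lemma positive_ex A B : ~ I A -> I B -> exists2 x, A x & ~ B x.
Proof.
move=> IA IB; apply: contrapT => H; apply: IA; apply: idealS IB => x Ax.
by apply: contrapT => nBx; apply: H; exists x.
Qed.

Definition cls A B (BA : B `<=` A) (Bpos : ~ I B) : quot I A :=
  exist _ (quot_class I A B) (ex_intro _ B (And3 BA Bpos erefl)).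

Definition rep A (p : quot I A) : set Z := projT1 (cid (proj2_sig p)).

Lemma rep_sub A (p : quot I A) : rep p `<=` A.
Proof. by rewrite /rep; case: cid => B []. Qed.

Lemma rep_pos A (p : quot I A) : ~ I (rep p).
Proof. by rewrite /rep; case: cid => B []. Qed.

Let quot_classE A (p : quot I A) : proj1_sig p = quot_class I A (rep p).
Proof. by rewrite /rep; case: cid => B []. Qed.

Let symdiff (A B C : set Z) : I (A `+` B) -> I (A `+` C) -> I (B `\` C).
Proof.
move=> IAB IAC; apply: ideal_cover IAB IAC _ => x [Bx nCx].
by have [Ax|nAx] := pselect (A x); [right; left|left; right].
Qed.

Let symdiffxx (A : set Z) : I (A `+` A).
Proof. by apply: idealS ideal0 => x [[]|[]]. Qed.

Lemma quot_leP A (p q : quot I A) : quot_le p q <-> I (rep p `\` rep q).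
Proof.
rewrite /quot_le !quot_classE; split.
  move=> [B [C [[_ pB] [_ qC] BC]]].
  have Cq := symdiff qC (symdiffxx (rep q)).
  have pB' := symdiff (symdiffxx (rep p)) pB.
  apply: ideal_cover (idealU pB' BC) Cq _ => x [px nqx].
  have [Bx|nBx] := pselect (B x); last by left; left.
  have [Cx|nCx] := pselect (C x); first by right.
  by left; right.
move=> pq; exists (rep p), (rep q).
by split=> //; (split; [exact: rep_sub|exact: symdiffxx]).
Qed.

Lemma rep_cls A B (BA : B `<=` A) (Bpos : ~ I B) :
  I (rep (cls BA Bpos) `\` B) /\ I (B `\` rep (cls BA Bpos)).
Proof.
have E := quot_classE (cls BA Bpos).
have : proj1_sig (cls BA Bpos) B by split.
rewrite E => -[_ rB]; split; first exact: symdiff (symdiffxx _) rB.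
exact: symdiff rB (symdiffxx _).
Qed.

Lemma ideal_diff_trans A B C : I (A `\` B) -> I (B `\` C) -> I (A `\` C).
Proof.
move=> AB BC; apply: ideal_cover AB BC _ => x [Ax nCx].
by have [Bx|nBx] := pselect (B x); [right|left].
Qed.

Lemma quot_le_cls A (p : quot I A) B (BA : B `<=` A) (Bpos : ~ I B) :
  quot_le p (cls BA Bpos) <-> I (rep p `\` B).
Proof.
have [rB Br] := rep_cls BA Bpos.
by rewrite quot_leP; split=> /ideal_diff_trans; apply.
Qed.

Lemma quot_cls_le A (p : quot I A) B (BA : B `<=` A) (Bpos : ~ I B) :
  quot_le (cls BA Bpos) p <-> I (B `\` rep p).
Proof.
have [rB Br] := rep_cls BA Bpos.
by rewrite quot_leP; split; exact: ideal_diff_trans.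
Qed.

Lemma quot_le_refl A (p : quot I A) : quot_le p p.
Proof. by apply/quot_leP; rewrite setDv; exact: ideal0. Qed.

Lemma quot_le_trans A (p q r : quot I A) : quot_le p q -> quot_le q r -> quot_le p r.
Proof. by move=> /quot_leP pq /quot_leP qr; apply/quot_leP; exact: ideal_diff_trans pq qr. Qed.

(** A dense subset of the quotient given by representatives, possibly with repetitions. *)
Definition dense_family X (D : X -> set Z) :=
  (forall a, ~ I (D a)) /\ forall S, ~ I S -> exists a, I (D a `\` S).

Lemma dense_le_family (nu : cardinal) :
  dense_le (@quot_le Z I setT) nu -> exists D : nu -> set Z, dense_family D.
Proof.
move=> [D Ddense /(card_le_surj (cls (@subsetT _ setT) idealT))[f fsurj]].
exists (fun a => rep (f a)); split=> [a|S Spos]; first exact: rep_pos.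
have [q /fsurj[a <-]] := Ddense (cls (@subsetT _ S) Spos).
by move=> /quot_le_cls; exists a.
Qed.

(** One positive [D a] cannot be almost included in two sets whose intersection is null. *)
Lemma family_antichain_le X T (D : X -> set Z) (F : set T) (A : T -> set Z) :
  dense_family D -> (forall x, F x -> ~ I (A x)) ->
  (forall x y, F x -> F y -> x <> y -> I (A x `&` A y)) -> F #<= [set: X].
Proof.
move=> [Dpos Ddense] Apos Adisj.
have [->|/set0P[x0 Fx0]] := eqVneq F set0; first exact: card_ge0.
have [a0 _] := Ddense _ (Apos _ Fx0).
have /choice[f fP] x : exists a, F x -> I (D a `\` A x).
  by have [/Apos/Ddense[a]|nF] := pselect (F x); [exists a|exists a0].
apply: (@inj_on_card_le _ _ _ _ f) => // x y Fx Fy fxy.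
apply: contrapT => /Adisj-/(_ Fx Fy) Axy; apply: (Dpos (f x)).
have Iy := fP _ Fy; rewrite -fxy in Iy.
apply: ideal_cover (idealU (fP _ Fx) Iy) Axy _ => z Dz.
have [Ax|nAx] := pselect (A x z); last by left; left.
by have [Ay|nAy] := pselect (A y z); [right|left; right].
Qed.

Lemma saturated_family_lt (nu : cardinal) T (F : set T) (A : T -> set Z) :
  saturated (@quot_le Z I setT) nu -> (forall x, F x -> ~ I (A x)) ->
  (forall x y, F x -> F y -> x <> y -> I (A x `&` A y)) -> ~ ([set: nu] #<= F).
Proof.
move=> sat Apos Adisj nuF.
(* The class of [setT] is a dummy value, never taken for [x] in [F]. *)
pose c x := if pselect (I (A x)) is right Ax then cls (@subsetT _ (A x)) Ax
            else cls (@subsetT _ setT) idealT.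
have cE x : F x -> exists Ax : ~ I (A x), c x = cls (@subsetT _ (A x)) Ax.
  move=> Fx; rewrite /c; case: (pselect (I (A x))) => [/(Apos _ Fx)//|Ax].
  by exists Ax.
have cdisj x y : F x -> F y -> x <> y -> ~ compatible (@quot_le _ I setT) (c x) (c y).
  move=> Fx Fy /(Adisj _ _ Fx Fy) Axy [r []].
  have [Ax ->] := cE _ Fx; have [Ay ->] := cE _ Fy.
  move=> /quot_le_cls rx /quot_le_cls ry; apply: (rep_pos (p := r)).
  apply: ideal_cover (idealU rx ry) Axy _ => z rz.
  have [{}Ax|nAx] := pselect (A x z); last by left; left.
  by have [{}Ay|nAy] := pselect (A y z); [right|left; right].
have cinj x y : F x -> F y -> c x = c y -> x = y.
  move=> Fx Fy cxy; apply: contrapT => /(cdisj _ _ Fx Fy); apply.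
  by rewrite cxy; exists (c y); split; exact: quot_le_refl.
have [|_] := sat (c @` F).
  move=> _ _ [x Fx <-] [y Fy <-] cxy; apply: cdisj => // xy.
  by rewrite xy in cxy.
apply; apply: card_le_trans nuF _.
by apply: (@inj_on_card_le _ _ _ _ c) => // x Fx; exists x.
Qed.

Lemma succ_saturated_family_le (nu : cardinal) T (F : set T) (A : T -> set Z) :
  succ_saturated (@quot_le Z I setT) nu -> (forall x, F x -> ~ I (A x)) ->
  (forall x y, F x -> F y -> x <> y -> I (A x `&` A y)) -> F #<= [set: nu].
Proof.
move=> [nu' nuS sat] Apos Adisj; apply: (lt_succ_le nuS).
exact: saturated_family_lt sat Apos Adisj.
Qed.

Lemma succ_saturated_antichain_le (nu : cardinal) :
  (forall F : set (set Z), (forall A, F A -> ~ I A) ->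
     (forall A B, F A -> F B -> A <> B -> I (A `&` B)) -> F #<= [set: nu]) ->
  succ_saturated (@quot_le Z I setT) nu.
Proof.
move=> H; have [nu' nuS] := succ_exists nu; exists nu' => // A anti.
have repI p q : A p -> A q -> p <> q -> I (rep p `&` rep q).
  move=> Ap Aq pq; apply: contrapT => pos; apply: (anti _ _ Ap Aq pq).
  exists (cls (@subsetT _ _) pos); rewrite !quot_cls_le; split.
    by apply: idealS ideal0 => z [[]].
  by apply: idealS ideal0 => z [[]].
have Ale : A #<= [set: nu].
  have rinj p q : A p -> A q -> rep p = rep q -> p = q.
    move=> Ap Aq pq; apply: contrapT => /(repI _ _ Ap Aq).
    by rewrite pq setIid; exact: rep_pos.
  apply: card_le_trans (H (@rep setT @` A) _ _).
  - by apply: (@inj_on_card_le _ _ _ _ (@rep setT)) => // p Ap; exists p.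
  - by move=> _ [p _ <-]; exact: rep_pos.
  - move=> _ _ [p Ap <-] [q Aq <-] pq; apply: repI => // e.
    by rewrite e in pq.
have [[nunu' nnu'] _] := nuS.
split; first exact: card_le_trans Ale nunu'.
by move=> nuA; apply: nnu'; exact: card_le_trans nuA Ale.
Qed.

(** [complete_ideal] also asks that the family embed into [kappa]; comparability of cardinals
    derives this from the failure of the converse embedding. *)
Lemma complete_bigcup (kappa : cardinal) X (B : set X) (A : X -> set Z) :
  complete_ideal kappa I -> ~ ([set: kappa] #<= B) -> 
  (forall x, B x -> I (A x)) -> I [set z | exists2 x, B x & A x z].
Proof.
move=> comp nB IA; apply: (@idealS _ (\bigcup_(C in A @` B) C)).
  by move=> z [x Bx Az]; exists (A x) => //; exists x.
apply: comp => [_ [x Bx <-]|]; first exact: IA.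
have nAB : ~ ([set: kappa] #<= A @` B).
  by move=> kAB; apply: nB; apply: card_le_trans kAB (card_image_le _ _).
split=> //.
have [[u /card_le_trans le_u]|] := card_compare {C | (A @` B) C} kappa.
  rewrite -(card_le_eql (sig_card_eq _)); apply: le_u; exact: card_leT.
by rewrite (card_le_eqr (sig_card_eq _)).
Qed.

End Ideal.

(** * Normal dense ideals *)

Section Normalize.
Variables (mu kappa : cardinal) (mu_inf : infinite_set [set: mu]).
Hypothesis kappa_succ : is_succ_of mu kappa.
Variables (I : set (set kappa)) (hI : is_ideal I).
Hypotheses (I_fine : fine_ideal (@clt kappa) I) (I_comp : complete_ideal kappa I).
Variables (D : kappa -> set kappa) (D_dense : dense_family I D).

Local Notation "a < b" := (clt a b).

(** Fewer than [kappa] indices lie strictly below [c]; the index [c] itself is added by hand. *)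
Lemma ideal_le_bigcup (A : kappa -> set kappa) (c : kappa) :
  (forall a, ~ c < a -> I (A a)) -> I [set x | exists2 a, ~ c < a & A a x].
Proof.
move=> IA; have IAc : I (A c) by apply: IA; exact: (wo_irr (wo_card kappa)).
have := @complete_bigcup _ _ hI kappa _ (seg (@clt kappa) c) A I_comp (@seg_lt _ c).
move=> H; apply: (ideal_cover hI (H _) IAc) => [a ac|x [a nca Aax]].
  by apply: IA; exact: (wo_nlt (wo_card kappa)).
case: (clt_total c a) => [//|[ca|ac]]; first by right; rewrite ca.
by left; exists a.
Qed.

(** In a generic ultrapower by [I] below [A], such a [phi] represents an element above every ordinal
    less than [kappa]. *)
Definition unbounded_on (A : set kappa) (phi : kappa -> kappa) :=
  forall c, I [set x | A x /\ ~ c < phi x].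

(* The functions given on positive subsets B_a of the dense sets D_a are glued
   along the least index a with x in B_a. *)
Lemma smaller_unbounded (phi : kappa -> kappa) :
  (forall A, ~ I A -> exists B psi, [/\ B `<=` A, ~ I B, unbounded_on B psi
     & forall x, B x -> psi x < phi x]) ->
  exists psi, unbounded_on setT psi /\ I [set x | ~ psi x < phi x].
Proof.
case: D_dense => Dpos Ddense H.
have /choice[B] a := H _ (Dpos a); move/choice => -[psi BP].
have /choice[m mP] x : exists a, (exists b, B b x) ->
    B a x /\ forall b, B b x -> ~ b < a.
  have [Bx|nBx] := pselect (exists b, B b x); last by exists x.
  by have [a Ba amin] := wo_min (wo_card kappa) (A := [set b | B b x]) Bx; exists a.
exists (fun x => psi (m x) x); split.
  move=> c; set Y := [set x | _]; apply: contrapT => /Ddense[a DaY].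
  have [BD Bpos _ _] := BP a; apply: Bpos.
  (* On [B a] the least index is at most [a], so only the null sets [A b] with [b] up to [a]
     matter. *)
  pose A b := [set x | B b x /\ ~ c < psi b x].
  apply: (ideal_cover hI DaY (ideal_le_bigcup (A := A) (c := a) _)).
    by move=> b _; case: (BP b) => _ _ + _; exact.
  move=> x Bax; have [Yx|nYx] := pselect (Y x); last by left; split=> //; exact: BD.
  have [Bm mmin] := mP x (ex_intro _ a Bax).
  by right; exists (m x); [exact: mmin|split=> //; case: Yx].
apply: (@idealS _ _ hI _ [set x | ~ exists a, B a x]).
  by move=> x nlt [a Bax]; apply: nlt; have [Bm _] := mP x (ex_intro _ a Bax);
     case: (BP (m x)) => _ _ _; exact.
apply: contrapT => /Ddense[a DaN]; have [BD Bpos _ _] := BP a; apply: Bpos.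
apply: (idealS hI) DaN => x Bax; split; first exact: BD.
by apply; exists a.
Qed.

(** Otherwise [smaller_unbounded] leads from the identity through a sequence of functions, each
    almost everywhere below the one before. By countable completeness some point then carries an
    infinite descending sequence. *)
Lemma minimal_unbounded : exists A phi, [/\ ~ I A, unbounded_on setT phi
  & forall B psi, B `<=` A -> ~ I B -> (forall x, B x -> psi x < phi x) ->
    ~ unbounded_on B psi].
Proof.
apply: contrapT => H.
have step (s : {phi | unbounded_on setT phi}) :
    exists t : {phi | unbounded_on setT phi},
      I [set x | ~ proj1_sig t x < proj1_sig s x].
  case: s => phi unb_phi /=.
  have [A Apos|psi [unb_psi lt_psi]] := @smaller_unbounded phi; last first.
    by exists (exist _ psi unb_psi).
  apply: contrapT => nB; apply: H; exists A, phi; split=> // B psi BA Bpos lt_psi unb_psi.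
  by apply: nB; exists B, psi.
have [next nextP] := choice step.
have unb_id : unbounded_on setT id.
  by move=> c; apply: (idealS hI) (I_fine c) => x [].
pose s n := iter n next (exist _ id unb_id).
have sI n : I [set x | ~ proj1_sig (s n.+1) x < proj1_sig (s n) x] by exact: nextP.
have nle : ~ ([set: kappa] #<= [set: nat]).
  case: kappa_succ => -[_ nkmu] _ knat; apply: nkmu; apply: card_le_trans knat _.
  exact/infiniteP.
have := complete_bigcup hI I_comp nle (fun n _ => sI n).
move=> /(positive_ex hI (idealT hI))[x _ nx].
have [|a [n _ <-] amin] := wo_min (wo_card kappa) (A := range (fun n => proj1_sig (s n) x)).
  by exists x; exists 0.
apply: nx; exists n => // lt_s; apply: amin lt_s; by exists n.+1.
Qed.

(** [I'] is the image under a minimal [phi] of the restriction of [I] to [A]. Unboundedness of [phi]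
    makes it fine and minimality makes it normal. Each [D a] almost included in [A] is replaced by
    the smallest set modulo [I'] whose preimage almost covers it. *)
Lemma normal_dense_ideal_exists : exists I' : set (set kappa),
  [/\ is_ideal I', fine_ideal (@clt kappa) I', complete_ideal kappa I'
    & normal_ideal (@clt kappa) I'] /\
  exists D' : kappa -> set kappa, dense_family I' D'.
Proof.
have [A [phi [Apos phi_unb phi_min]]] := minimal_unbounded.
case: D_dense => Dpos Ddense.
(* On a positive set, a choice [psi x] of such an [a] would be below [phi] and unbounded, because
   values up to [c] occur only on a null union of sets [N a]. Minimality of [phi] excludes this. *)
have phi_normal (N : kappa -> set kappa) : (forall a, I (A `&` N a)) ->
    I [set x | A x /\ exists2 a, a < phi x & N a x].
  move=> IN; set B := [set x | _]; apply: contrapT => Bpos.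
  have /choice[psi psiP] x : exists a, B x -> a < phi x /\ N a x.
    have [[_ [a ax Na]]|nB] := pselect (B x); first by exists a.
    by exists x.
  have BA : B `<=` A by move=> x [].
  apply: (phi_min B psi BA Bpos) => [x /psiP[]//|c].
  apply: (idealS hI) (ideal_le_bigcup (c := c) (fun a _ => IN a)) => x [Bx nc].
  by exists (psi x) => //; split; [exact: BA|case: (psiP _ Bx)].
pose I' X := I (A `&` phi @^-1` X).
have I'P : is_ideal I'.
  split.
  - by rewrite /I' preimage_set0 setI0; exact: ideal0.
  - by move=> X Y XY; apply: (idealS hI) => x [Ax /XY].
  - by move=> X Y; rewrite /I' preimage_setU setIUr; exact: idealU.
  - by rewrite /I' preimage_setT setIT.
exists I'; split; first split=> //.
- by move=> c; apply: (idealS hI) (phi_unb c) => x [].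
- move=> F FI [_ nF]; rewrite /I' preimage_bigcup setI_bigcupr.
  pose N X := A `&` phi @^-1` X.
  apply: (idealS hI) (complete_bigcup hI (A := N) I_comp nF _) => [x [X FX Xx]|X /FI//].
  by exists X.
- move=> N IN; have := phi_normal (fun a => phi @^-1` N a) IN.
  apply: (idealS hI) => x [Ax [a [ax Na]]]; split=> //.
  by exists a.
(* Within [A], the preimage of [X a b] almost misses [D a] and almost covers [D b], provided that
   some set does both. *)
have /choice[X] a : exists X : kappa -> set kappa, forall b,
    I (A `&` phi @^-1` X b `&` D a) /\
    ((exists X', I (A `&` phi @^-1` X' `&` D a) /\ I (D b `\` (A `&` phi @^-1` X'))) ->
     I (D b `\` (A `&` phi @^-1` X b))).
  suff H b : exists X, I (A `&` phi @^-1` X `&` D a) /\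
      ((exists X', I (A `&` phi @^-1` X' `&` D a) /\ I (D b `\` (A `&` phi @^-1` X'))) ->
       I (D b `\` (A `&` phi @^-1` X))) by have [X XP] := choice H; exists X.
  have [[X [? ?]]|nX] := pselect (exists X',
    I (A `&` phi @^-1` X' `&` D a) /\ I (D b `\` (A `&` phi @^-1` X'))).
    by exists X.
  exists set0; split=> //; by rewrite preimage_set0 setI0 set0I; exact: ideal0.
move=> XP.
(* The diagonal union keeps missing [D a] by [phi_normal], and modulo [I'] it includes every set
   whose preimage misses [D a]. Its complement is therefore the projection of [D a]. *)
pose Y a := [set y | exists2 b, b < y & X a b y].
have YI a : I (A `&` phi @^-1` Y a `&` D a).
  have := phi_normal (fun b => phi @^-1` X a b `&` D a) _.
  move=> H; apply: (idealS hI) (H _) => [x [[Ax [b bx Xb]] Da]|b].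
    by split=> //; exists b.
  by rewrite setIA; case: (XP a b).
(* [setT] is a filler for those [a] with [D a] not almost included in [A]. *)
exists (fun a => if pselect (I (D a `\` A)) then ~` Y a else setT); split.
  move=> a; case: (pselect (I (D a `\` A))) => /= [IDA IY|_].
    apply: (Dpos a); apply: (ideal_cover hI (idealU hI IDA (YI a)) IY) => x Dx.
    have [Ax|nAx] := pselect (A x); last by left; left.
    by have [Yx|nYx] := pselect (Y a (phi x)); [left; right|right].
  exact: idealT.
move=> S /Ddense[a Da]; exists a.
have IDA : I (D a `\` A) by apply: (idealS hI) Da => x [Dx nAx]; split=> // -[].
case: (pselect (I (D a `\` A))) => //= _.
apply: contrapT => X'pos; pose X' := ~` Y a `\` S.
(* The preimage of [X'] misses [D a] and covers [D b], so [X a b] covers [D b] too. Where [phi]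
   exceeds [b], this leads into [Y a], which [X'] avoids. *)
have [b Db] := Ddense _ X'pos.
suff : I (D b `\` (A `&` phi @^-1` X a b)); last first.
  case: (XP a b) => _; apply; exists X'; split=> //; apply: (idealS hI) Da => x [[Ax [_ nSx]] Dx].
  by split=> // -[].
apply/(positive_cover hI (Dpos b) (idealU hI Db (phi_unb b))) => x Dx.
have [[Ax [nYx nSx]]|nX'] := pselect ((A `&` phi @^-1` X') x); last by left; left.
have [bx|nbx] := pselect (b < phi x); last by left; right.
right; split=> // -[_ Xx]; apply: nYx; by exists b.
Qed.

End Normalize.

(** * The iterated ideal *)

Section Enum.
Variables (lambda kappa : cardinal).
Implicit Type z : subsets_ot lambda kappa.

Definition enum_ot z : kappa -> lambda := projT1 (cid (proj2_sig z)).

Lemma enum_ot_lt z a b : clt a b <-> clt (enum_ot z a) (enum_ot z b).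
Proof. by rewrite /enum_ot; case: cid => f []. Qed.

Lemma mem_otP x z : mem_ot x z <-> exists a, enum_ot z a = x.
Proof.
rewrite /enum_ot /mem_ot; case: cid => f [_ /= <-].
by split=> [[a _ <-]|[a <-]]; [exists a|exists a].
Qed.

Lemma mem_enum_ot z a : mem_ot (enum_ot z a) z.
Proof. by apply/mem_otP; exists a. Qed.

Lemma enum_ot_inj z a b : enum_ot z a = enum_ot z b -> a = b.
Proof.
move=> e; case: (clt_total a b) => [|[//|]] /(enum_ot_lt z);
  rewrite e => h; by case: (wo_irr (wo_card lambda) h).
Qed.

End Enum.

Section Iterate.
Variables (lambda kappa : cardinal).
Local Notation Z := (subsets_ot lambda kappa).
Variables (I : set (set kappa)) (J : set (set Z)).
Hypotheses (hI : is_ideal I) (hJ : is_ideal J).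
Hypotheses (I_fine : fine_ideal (@clt kappa) I) (J_fine : fine_ideal (@mem_ot lambda kappa) J).
Hypotheses (I_comp : complete_ideal kappa I) (J_comp : complete_ideal kappa J).
Hypothesis I_normal : normal_ideal (@clt kappa) I.
Hypothesis J_normal : normal_ideal (@mem_ot lambda kappa) J.
Variables (D : kappa -> set kappa) (D_dense : dense_family I D).

(* Forcing with [iter_ideal] amounts to forcing with [J] and then with the
   image of [I], an ideal on [lambda], under the generic embedding; [trace_ideal]
   is the trace of the latter on the ground model. *)
Definition iter_ideal : set (set (lambda * Z)) :=
  [set S | J [set z | ~ I [set a | S (enum_ot z a, z)]]].

Definition trace_ideal : set (set lambda) :=
  [set X | iter_ideal [set w | X w.1]].

Lemma iter_idealP : is_ideal iter_ideal.
Proof.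
split.
- apply: (idealS hJ) (ideal0 hJ) => z; apply; apply: (idealS hI) (ideal0 hI) => a.
  by case.
- move=> S S' SS'; apply: (idealS hJ) => z nS IS'; apply: nS.
  by apply: (idealS hI) IS' => a /SS'.
- move=> S S' LS LS'; apply: (ideal_cover hJ LS LS') => z nU.
  have [IS|] := pselect (I [set a | S (enum_ot z a, z)]); last by left.
  by right=> IS'; apply: nU; apply: (ideal_cover hI IS IS').
- move=> LT; apply: (idealT hJ); apply: (idealS hJ) LT => z _.
  exact: idealT.
Qed.

Lemma trace_idealP : is_ideal trace_ideal.
Proof.
have hL := iter_idealP; split.
- by apply: (idealS hL) (ideal0 hL) => w [].
- by move=> X Y XY; apply: (idealS hL) => w /XY.
- by move=> X Y LX LY; apply: (ideal_cover hL LX LY).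
- by move=> LT; apply: (idealT hL); apply: (idealS hL) LT.
Qed.

Lemma trace_fine : fine_ideal (@clt lambda) trace_ideal.
Proof.
move=> c; apply: (idealS hJ) (J_fine c) => z /= nI /mem_otP[a0 ca].
apply: nI; apply: (idealS hI) (I_fine a0) => a /=; rewrite -ca.
by move=> nlt /(enum_ot_lt z).
Qed.

(** Fineness puts each [g x] into almost every [z]; normality of [J] then makes almost every [z]
    closed under [g]. *)
Lemma iter_closed (g : lambda -> lambda) :
  iter_ideal [set w | ~ mem_ot (g w.1) w.2].
Proof.
apply: (idealS hJ) (J_normal (fun x => J_fine (g x))) => z nI.
apply: contrapT => nz; apply: nI; apply: (idealS hI) (ideal0 hI) => a /= na.
by apply: nz; exists (enum_ot z a); split=> //; exact: mem_enum_ot.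
Qed.

(** For almost every [z], normality of [J] makes the pulled-back sections null for all [c] in [z] at
    once. Through [enum_ot] the union over these [c] becomes a diagonal union on [kappa], where
    normality of [I] applies. *)
Lemma iter_ideal_diag (S : lambda -> set (lambda * Z)) :
  (forall c, iter_ideal (S c)) ->
  iter_ideal [set w | exists c, [/\ clt c w.1, mem_ot c w.2 & S c w]].
Proof.
move=> LS; apply: (idealS hJ) (J_normal LS) => z nI; apply: contrapT => nz.
apply: nI; pose N a := [set b | S (enum_ot z a) (enum_ot z b, z)].
have IN a : I (N a).
  by apply: contrapT => nN; apply: nz; exists (enum_ot z a); split=> //; exact: mem_enum_ot.
apply: (idealS hI) (I_normal IN) => b /= [c [cb /mem_otP[a ac] Sc]].
by exists a; split; [rewrite (enum_ot_lt z) ac|rewrite /N /= ac].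
Qed.

(** Almost every [z] is closed under a choice [g] of witnesses, which supplies the condition
    [mem_ot c w.2] of [iter_ideal_diag]. *)
Lemma trace_normal : normal_ideal (@clt lambda) trace_ideal.
Proof.
move=> X TX; have hL := iter_idealP.
have /choice[g gP] x : exists c, (exists c', clt c' x /\ X c' x) -> clt c x /\ X c x.
  have [[c cP]|nX] := pselect (exists c', clt c' x /\ X c' x); first by exists c.
  by exists x.
apply: (ideal_cover hL (iter_closed g) (iter_ideal_diag (S := fun c => [set w | X c w.1]) TX)).
move=> w /= /gP[gw Xw]; have [gz|] := pselect (mem_ot (g w.1) w.2); last by left.
by right; exists (g w.1).
Qed.

Lemma iter_ideal_complete X (S : X -> set (lambda * Z)) :
  ~ ([set: kappa] #<= [set: X]) -> (forall t, iter_ideal (S t)) ->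
  iter_ideal [set w | exists t, S t w].
Proof.
move=> nX LS; apply: (idealS hJ) (complete_bigcup hJ J_comp nX (fun t _ => LS t)).
move=> z nI; apply: contrapT => nz; apply: nI.
pose N t := [set a | S t (enum_ot z a, z)].
have IN t : I (N t) by apply: contrapT => nN; apply: nz; exists t.
apply: (idealS hI) (complete_bigcup hI I_comp nX (fun t _ => IN t)) => a [t St].
by exists t.
Qed.

(** At a [z] whose [a]-th element is [c], the section is the copy of [D a] in [z]: [c] names a
    member of the dense family whose index varies with [z]. *)
Definition dense_section (c : lambda) : set (lambda * Z) :=
  [set w | exists a b, [/\ enum_ot w.2 a = c, enum_ot w.2 b = w.1 & D a b]].

Lemma dense_section_pos (c : lambda) A : ~ J A ->
  ~ iter_ideal (dense_section c `&` [set w | A w.2]).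
Proof.
case: D_dense => Dpos _ Apos LA; apply: Apos.
apply: (ideal_cover hJ LA (J_fine c)) => z Az.
have [/mem_otP[a ac]|] := pselect (mem_ot c z); last by right.
left => Ia; apply: (Dpos a); apply: (idealS hI) Ia => b Dab; split=> //.
by exists a, b.
Qed.

(** If [D (d z)] lies below the section of [S] at [z], then [enum_ot z (d z)] is a choice of a
    member of [z], constant on a positive set by normality of [J]. *)
Lemma dense_section_dense S : ~ iter_ideal S ->
  exists c A, ~ J A /\ iter_ideal ((dense_section c `&` [set w | A w.2]) `\` S).
Proof.
case: D_dense => _ Ddense Spos.
pose Sz z := [set a | S (enum_ot z a, z)].
have [a0 _] := Ddense _ (idealT hI).
have /choice[d dP] z : exists a, ~ I (Sz z) -> I (D a `\` Sz z).
  by have [Iz|/Ddense[a]] := pselect (I (Sz z)); [exists a0|exists a].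
pose A c := [set z | ~ I (Sz z) /\ enum_ot z (d z) = c].
have [c Ac] : exists c, ~ J (A c).
  apply: contrapT => nA; apply: Spos.
  have JA c : J (A c) by apply: contrapT => nc; apply: nA; exists c.
  apply: (idealS hJ) (J_normal JA) => z Iz; exists (enum_ot z (d z)).
  by split; [exact: mem_enum_ot|split].
exists c, (A c); split=> //; apply: (idealS hJ) (ideal0 hJ) => z; apply.
have [[/dP Iz dc]|nAz] := pselect (A c z); last first.
  by apply: (idealS hI) (ideal0 hI) => b [[_ /nAz]].
apply: (idealS hI) Iz => b [[[a [b' [/= ac /enum_ot_inj-> Dab]]] _] nS].
split=> //; suff <- : a = d z by [].
by apply: (@enum_ot_inj _ _ z); rewrite dc.
Qed.

(** Each member almost includes some [dense_section c] restricted to a positive [A]. For fixed [c]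
    the sets [A] form an antichain modulo [J], so the family has at most [lambda * lambda]
    members. *)
Lemma iter_ideal_saturated T (F : set T) (S : T -> set (lambda * Z)) :
  infinite_set [set: lambda] -> succ_saturated (@quot_le Z J setT) lambda ->
  (forall x, F x -> ~ iter_ideal (S x)) ->
  (forall x y, F x -> F y -> x <> y -> iter_ideal (S x `&` S y)) ->
  F #<= [set: lambda].
Proof.
move=> lam_inf sat Spos Sdisj; have hL := iter_idealP.
have [c0 _] := infinite_setN0 lam_inf.
have /choice[c] x : exists c, exists A, F x ->
    ~ J A /\ iter_ideal ((dense_section c `&` [set w | A w.2]) `\` S x).
  have [/Spos/dense_section_dense[c [A cA]]|nF] := pselect (F x).
    by exists c, A.
  by exists c0, set0.
move=> /choice[A cA].
apply: (@card_le_sum lambda _ _ _ c) => // [|c1]; first exact: card_leT.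
apply: (succ_saturated_family_le (A := A) hJ sat) => [x [/cA[]//]|].
move=> x y [Fx cx] [Fy cy] xy; apply: contrapT => /(@dense_section_pos c1); apply.
have [_ Lx] := cA _ Fx; have [_ Ly] := cA _ Fy; rewrite /= in cx cy.
rewrite cx in Lx; rewrite cy in Ly.
apply: (ideal_cover hL (idealU hL Lx Ly) (Sdisj _ _ Fx Fy xy)) => w [cw [Ax Ay]].
have [Sx|nSx] := pselect (S x w); last by left; left.
by have [Sy|nSy] := pselect (S y w); [right|left; right].
Qed.

Lemma iter_ideal_dense_family (E : lambda -> set Z) :
  infinite_set [set: lambda] -> dense_family J E ->
  exists R : lambda -> set (lambda * Z), dense_family iter_ideal R.
Proof.
move=> lam_inf [Epos Edense]; have [c0 _] := infinite_setN0 lam_inf.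
have [p pP] := card_le_surj (c0, c0) (cardinal_square lam_inf).
pose R c := dense_section (p c).1 `&` [set w | E (p c).2 w.2].
exists R; split=> [c|S /dense_section_dense[c [A [/Edense[e EA] LA]]]].
  exact: dense_section_pos.
have [x px] := pP (c, e) Logic.I; exists x; rewrite /R px /=.
have hL := iter_idealP.
have LE : iter_ideal [set w | (E e `\` A) w.2].
  apply: (idealS hJ) EA => z nI; apply: contrapT => nEA; apply: nI.
  by apply: (idealS hI) (ideal0 hI) => a /nEA.
apply: (ideal_cover hL LE LA) => w [[cw Ew] nS].
by have [Aw|nAw] := pselect (A w.2); [right|left].
Qed.

(* There are more than [lambda] pairwise eventually different functions below a
   fixed [h]; on almost every [z] they take fewer than [kappa] values below [h],
   so completeness makes them contradict saturation. *)
Lemma weakly_inaccessible_false (mu : cardinal) :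
  infinite_set [set: mu] -> is_succ_of mu kappa ->
  weakly_inaccessible lambda -> cardinal_lt kappa lambda ->
  succ_saturated (@quot_le Z J setT) lambda -> False.
Proof.
move=> mu_inf kS [_ [[lam_inf _] lam_lim]] [klam _] sat; have hL := iter_idealP.
have [c0 _] := infinite_setN0 lam_inf.
have low := wo_card lambda.
(* As [lambda] is a limit cardinal, some [h x] has more predecessors than [x]. *)
have /choice[h hP] x : exists y, ~ (seg (@clt lambda) y #<= seg (@clt lambda) x).
  have [rho rhox] := cardinal_of {y | seg (@clt lambda) x y}.
  rewrite (card_eqr (sig_card_eq _)) in rhox.
  have [|sigma [[_ nsigma] [_ nlam]]] := lam_lim rho.
    split; first by rewrite (card_le_eql rhox); exact: card_leT.
    by rewrite (card_le_eqr rhox); exact: seg_lt.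
  have [[y sy]|//] := card_compare sigma lambda.
  exists y => yx; apply: nsigma; rewrite (card_le_eqr rhox).
  exact: card_le_trans sy yx.
pose diff (g g' : lambda -> lambda) := exists c, forall x, clt c x -> g x <> g' x.
pose good (F : set (lambda -> lambda)) := (forall g, F g -> forall x, clt (g x) (h x)) /\
  (forall g g', F g -> F g' -> g <> g' -> diff g g').
have [F [[Fh Fdiff] Fmax]] : exists F, good F /\ forall G, F `<` G -> ~ good G.
  apply: Zorn_bigcup => C Cgood Ctot; split=> [g [F /Cgood[Fh _] /Fh]//|].
  move=> g g' [F CF Fg] [F' CF' Fg'] gg'.
  have [FF'|F'F] := Ctot _ _ CF CF'.
    by have [_ d] := Cgood _ CF'; apply: d => //; exact: FF'.
  by have [_ d] := Cgood _ CF; apply: d => //; exact: F'F.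
(* If [e] coded [F] in [lambda], a function [g] could be added: [g x] avoids the values at [x] of
   the functions coded below [x], too few to exhaust the predecessors of [h x]. *)
have nF : ~ (F #<= [set: lambda]).
  move=> /(card_le_inj_on c0)[e [_ einj]].
  have /choice[g gP] x : exists y, clt y (h x) /\
      forall g', F g' -> clt (e g') x -> g' x <> y.
    apply: contrapT => /forallNP ny; apply: (hP x).
    apply: (@card_le_trans _ _ _ (F `&` [set g' | clt (e g') x])).
      apply: (@surj_on_card_le _ _ _ _ (fun g' => g' x)) => y yh.
      have /not_andP[//|/existsNP[g' /not_implyP[Fg']]] := ny y.
      move=> /not_implyP[eg' /contrapT g'y].
      by exists g'.
    by apply: (@inj_on_card_le _ _ _ _ e) => [g' []//|g1 g2 [F1 _] [F2 _]]; exact: einj.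
  have dg g' : F g' -> diff g' g.
    by move=> Fg'; exists (e g') => x ex; have [_ H] := gP x; exact: H.
  have [Fg|nFg] := pselect (F g).
    have [c gc] := dg _ Fg; have [x cx] := infinite_cardinal_nomax c lam_inf.
    exact: gc cx erefl.
  apply: (Fmax (g |` F)).
    by split=> [f Ff|FgF]; [right|apply: nFg; apply: FgF; left].
  split=> [g' [->|/Fh]//|g1 g2 [->|F1] [->|F2] n12].
  - by move=> x; case: (gP x).
  - by [].
  - by have [c dc] := dg _ F2; exists c => x /dc/nesym.
  - exact: dg.
  - exact: Fdiff.
have [m0 _] := infinite_setN0 mu_inf.
have /choice[e eP] (a : kappa) : exists e : kappa -> mu,
    forall b b', clt b a -> clt b' a -> e b = e b' -> b = b'.
  have /(card_le_inj_on m0)[e [_ einj]] := lt_succ_le kS (@seg_lt kappa a).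
  by exists e => b b'; exact: einj.
(* At [(x, z)] in this set, [h x] is the [a]-th and [g x] the [b]-th element of [z], and [t] numbers
   [b] among the predecessors of [a]. *)
pose B t (g : lambda -> lambda) : set (lambda * Z) := [set w | exists a b,
  [/\ clt b a, enum_ot w.2 a = h w.1, enum_ot w.2 b = g w.1 & e a b = t]].
(* Almost every [z] is closed under [g] and [h], so the sets [B t g] almost cover the whole space.
   There are only [mu] of them, and completeness makes one positive. *)
have /choice[t tP] g : exists t, F g -> ~ iter_ideal (B t g).
  have [Fg|] := pselect (F g); last by exists m0.
  apply: contrapT => /forallNP nt; apply: (idealT hL).
  have LB t : iter_ideal (B t g) by apply: contrapT => nB; apply: (nt t).
  have [[_ nk] _] := kS.
  apply: (ideal_cover hL (idealU hL (iter_closed h) (iter_closed g)) (iter_ideal_complete nk LB)).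
  move=> w _; have [/mem_otP[a ah]|] := pselect (mem_ot (h w.1) w.2); last by left; left.
  have [/mem_otP[b bg]|] := pselect (mem_ot (g w.1) w.2); last by left; right.
  right; exists (e a b), a, b; split=> //.
  by rewrite (enum_ot_lt w.2) ah bg; exact: Fh.
(* For a fixed [t1] the sets [B t1 g] are almost disjoint: at a common point both values carry the
   same number below the same [a], hence agree, which eventually different functions do only on a
   bounded set. *)
apply: nF; apply: (@card_le_sum lambda _ _ _ t) => // [|t1].
  apply: card_le_trans (card_leT _) _; apply: card_le_trans klam.
  by case: kS => -[].
apply: (iter_ideal_saturated (S := B t1) lam_inf sat) => [g [Fg <-]|g g' [Fg _] [Fg' _] gg'].
  exact: tP.
have [c dc] := Fdiff _ _ Fg Fg' gg'.
apply: (idealS hL) (trace_fine c) => w [].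
move=> [a [b [ba ah bg eab]]] [a' [b' [b'a' a'h b'g' ea'b']]] cw.
have aa' : a = a' by apply: (@enum_ot_inj _ _ w.2); rewrite ah a'h.
rewrite -aa' in b'a' ea'b'.
by apply: (dc _ cw); rewrite -bg -b'g' (eP a b b') // eab.
Qed.

End Iterate.

(** * The forcing relation *)

Section ForcingRelation.
Variables (P : Type) (le : P -> P -> Prop).
Hypotheses (le_refl : forall p, le p p)
  (le_trans : forall p q r, le p q -> le q r -> le p r).
Implicit Types (p q r : P) (s t u x y z : name P) (phi psi : formula (name P)).

Local Notation fo := (forces le).

Lemma forces_mono p q phi : le q p -> fo p phi -> fo q phi.
Proof.
elim: phi p q => [s t|s t|phi IH|phi IH psi IH'|F IH] p q qp /=.
- by case: t => B g d H r rq; apply: H; exact: le_trans rq qp.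
- case: s t => [A f c] [B g d] [H1 H2].
  by split=> i r rq; [apply: H1|apply: H2]; exact: le_trans rq qp.
- by move=> H r rq; apply: H; exact: le_trans rq qp.
- by move=> [H H']; split; [exact: IH H|exact: IH' H'].
- by move=> H s; exact: IH (H s).
Qed.

Lemma forces_dense p phi : (forall q, le q p -> exists2 r, le r q & fo r phi) -> fo p phi.
Proof.
elim: phi p => [s t|s t|phi IH|phi IH psi IH'|F IH] p H /=.
- case: t H => B g d H q qp; have [r rq /(_ r (le_refl r))[r' [r'r H']]] := H q qp.
  by exists r'; split=> //; exact: le_trans r'r rq.
- case: s t H => [A f c] [B g d] H; split=> i q qp qc; have [r rq [H1 H2]] := H q qp.
    have [r' [r'r H']] := H1 i r (le_refl r) (le_trans rq qc).
    by exists r'; split=> //; exact: le_trans r'r rq.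
  have [r' [r'r H']] := H2 i r (le_refl r) (le_trans rq qc).
  by exists r'; split=> //; exact: le_trans r'r rq.
- move=> q qp fq; have [r rq nr] := H q qp; apply: (nr r) => //.
  exact: forces_mono fq.
- split; [apply: IH|apply: IH'] => q qp; have [r rq [H1 H2]] := H q qp; by exists r.
- by move=> s; apply: IH => q qp; have [r rq Hr] := H q qp; exists r.
Qed.

Lemma forces_not p phi : fo p (FNot phi) <-> forall q, le q p -> ~ fo q phi.
Proof. by []. Qed.

(** [FImp] is a negated conjunction, which only gives conditions forcing [psi] densely below [q];
    [forces_dense] does the rest. *)
Lemma forces_imp p phi psi :
  fo p (FImp phi psi) <-> forall q, le q p -> fo q phi -> fo q psi.
Proof.
split=> [H q qp fq|H q qp [fq nq]]; last exact: nq (le_refl q) (H q qp fq).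
apply: forces_dense => r rq; apply: contrapT => nr; apply: (H r).
  exact: le_trans rq qp.
split; first exact: forces_mono fq.
by move=> r' r'r fr'; apply: nr; exists r'.
Qed.

Lemma forces_iff p phi psi :
  fo p (FIff phi psi) <-> forall q, le q p -> (fo q phi <-> fo q psi).
Proof.
split=> [[/forces_imp H /forces_imp H'] q qp|H]; first by split; [exact: H|exact: H'].
by split; apply/forces_imp => q qp; apply H.
Qed.

Lemma forces_or p phi psi :
  fo p (FOr phi psi) <-> forall q, le q p -> exists2 r, le r q & fo r phi \/ fo r psi.
Proof.
split=> [H q qp|H q qp [H1 H2]].
  apply: contrapT => nr; apply: (H q qp).
  by split=> r rq fr; apply: nr; exists r => //; [left|right].
by have [r rq [/H1|/H2]] := H q qp; exact.
Qed.

Lemma forces_ex p (F : name P -> formula (name P)) :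
  fo p (FEx F) <-> forall q, le q p -> exists2 r, le r q & exists x, fo r (F x).
Proof.
split=> [H q qp|H q qp H'].
  apply: contrapT => nr; apply: (H q qp) => x r rq fr; apply: nr; exists r => //.
  by exists x.
by have [r rq [x fr]] := H q qp; exact: H' x r rq fr.
Qed.

Lemma forces_allin p a (F : name P -> formula (name P)) :
  fo p (FAllIn a F) <-> forall x q, le q p -> fo q (FMem x a) -> fo q (F x).
Proof.
split=> [H x|H x]; last first.
  by change (fo p (FImp (FMem x a) (F x))); apply/forces_imp; exact: H.
by have /forces_imp : fo p (FImp (FMem x a) (F x)) := H x.
Qed.

Lemma forces_exin p a (F : name P -> formula (name P)) :
  fo p (FExIn a F) <-> forall q, le q p -> exists2 r, le r q &
    exists x, fo r (FMem x a) /\ fo r (F x).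
Proof. exact: forces_ex. Qed.

Lemma forces_sub p x y :
  fo p (FSub x y) <-> forall t q, le q p -> fo q (FMem t x) -> fo q (FMem t y).
Proof. exact: forces_allin. Qed.

Lemma forces_in_gen_ideal p lam I x : fo p (FInGenIdeal lam I x) <->
  fo p (FSub x lam) /\ (forall q, le q p -> exists2 r, le r q &
    exists y, fo r (FMem y I) /\ fo r (FSub x y)).
Proof.
rewrite -(forces_exin p I (fun y => FSub x y)).
by split=> -[H1 H2]; split.
Qed.

Lemma forces_eq_refl p s : fo p (FEq s s).
Proof.
elim: s p => A f IH c p /=.
by split=> i q qp qc; exists q; split=> //; exists i; split=> //; exact: IH.
Qed.

Lemma forces_eq_sym p s t : fo p (FEq s t) -> fo p (FEq t s).
Proof.
elim: s t p => A f IH c [B g d] p /= [H1 H2]; split=> i q qp qc.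
  by have [r [rq [j [rj /IH]]]] := H2 i q qp qc; exists r; split=> //; exists j.
by have [r [rq [j [rj /IH]]]] := H1 i q qp qc; exists r; split=> //; exists j.
Qed.

Lemma forces_eq_trans p s t u : fo p (FEq s t) -> fo p (FEq t u) -> fo p (FEq s u).
Proof.
elim: s t u p => A f IH c [B g d] [C h e] p /= [H1 H2] [H3 H4]; split=> i q qp qc.
  have [r [rq [j [rj fg]]]] := H1 i q qp qc.
  have [r' [r'r [k [r'k gh]]]] := H3 j r (le_trans rq qp) rj.
  exists r'; split; first exact: le_trans r'r rq.
  exists k; split=> //; apply: IH gh; exact: (forces_mono (phi := FEq _ _) r'r fg).
have [r [rq [j [rj gh]]]] := H4 i q qp qc.
have [r' [r'r [k [r'k fg]]]] := H2 j r (le_trans rq qp) rj.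
exists r'; split; first exact: le_trans r'r rq.
exists k; split=> //; apply: IH fg _; exact: (forces_mono (phi := FEq _ _) r'r gh).
Qed.

Lemma forces_mem_name p s A (f : A -> name P) c :
  fo p (FMem s (Name f c)) <-> forall q, le q p -> exists2 r, le r q &
    exists j, le r (c j) /\ fo r (FEq s (f j)).
Proof.
by split=> H q qp; have [r] := H q qp; [move=> [rq Hr]|move=> rq Hr]; exists r.
Qed.

Lemma forces_mem_eql p s s' t : fo p (FEq s s') -> fo p (FMem s t) -> fo p (FMem s' t).
Proof.
case: t => A f c ss' /forces_mem_name H; apply/forces_mem_name => q qp.
have [r rq [j [rj sj]]] := H q qp; exists r => //; exists j; split=> //.
apply: forces_eq_trans sj; apply: forces_eq_sym; apply: forces_mono ss'.
exact: le_trans rq qp.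
Qed.

Lemma forces_mem_eqr p s t t' : fo p (FEq t t') -> fo p (FMem s t) -> fo p (FMem s t').
Proof.
case: t t' => [A f c] [B g d] tt' /forces_mem_name H; apply/forces_mem_name => q qp.
have [r rq [j [rj sj]]] := H q qp.
have /= [H1 _] := tt'.
have [r' [r'r [k [r'k fg]]]] := H1 j r (le_trans rq qp) rj.
exists r'; first exact: le_trans r'r rq.
exists k; split=> //; apply: forces_eq_trans fg; exact: forces_mono sj.
Qed.

(** Quantified formulas are arbitrary functions of names, so replacing a name by an equal one is
    justified formula by formula. *)
Lemma forces_upair_eq p z x y y' :
  fo p (FEq y y') -> fo p (FIsUPair z x y) -> fo p (FIsUPair z x y').
Proof.
move=> yy' H t; change (fo p (FIff (FMem t z) (FOr (FEq t x) (FEq t y')))).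
apply/forces_iff => q qp.
have /forces_iff/(_ q qp) Ht : fo p (FIff (FMem t z) (FOr (FEq t x) (FEq t y))) := H t.
apply: (iff_trans Ht).
have qyy' : fo q (FEq y y') by exact: forces_mono yy'.
split=> /forces_or Hq; apply/forces_or => r rq; have [r' r'r tt] := Hq r rq;
  exists r' => //; (case: tt => tt; [by left|right]); apply: (forces_eq_trans tt);
  [|apply: forces_eq_sym]; apply: forces_mono qyy'; exact: le_trans r'r rq.
Qed.

Lemma forces_pairin_eq p x y y' f :
  fo p (FEq y y') -> fo p (FPairIn x y f) -> fo p (FPairIn x y' f).
Proof.
move=> yy' /forces_exin H; apply/forces_exin => q qp; have [r rq [z [zf zxy]]] := H q qp.
exists r => //; exists z; split=> //.
move/forces_ex: zxy => zxy; apply/forces_ex => r1 r1r.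
have [r2 r21 [s /forces_ex H2]] := zxy r1 r1r; exists r2 => //; exists s.
apply/forces_ex => r3 r32; have [r4 r43 [t [sx [txy zst]]]] := H2 r3 r32.
exists r4 => //; exists t; split=> //; split=> //.
apply: forces_upair_eq txy; apply: forces_mono yy'.
exact: le_trans r43 (le_trans r32 (le_trans r21 (le_trans r1r (le_trans rq qp)))).
Qed.

Lemma forces_injection p f a b : fo p (FInjection f a b) ->
  (forall x q, le q p -> fo q (FMem x a) -> exists2 r, le r q &
     exists y, fo r (FMem y b) /\ fo r (FPairIn x y f)) /\
  (forall x y z q, le q p -> fo q (FMem x a) -> fo q (FMem y a) -> fo q (FMem z b) ->
     fo q (FPairIn x z f) -> fo q (FPairIn y z f) -> fo q (FEq x y)).
Proof.
move=> [_ [tot [_ inj]]]; split.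
  have {}tot : fo p (FAllIn a (fun x => FExIn b (fun y => FPairIn x y f))) := tot.
  move=> x q qp xa; move/forces_allin: tot => /(_ x q qp xa)/forces_exin.
  by move=> /(_ q (le_refl q)).
have {}inj : fo p (FAllIn a (fun x => FAllIn a (fun y => FAllIn b (fun z =>
  FImp (FAnd (FPairIn x z f) (FPairIn y z f)) (FEq x y))))) := inj.
move=> x y z q qp xa ya zb xz yz.
move/forces_allin: inj => /(_ x q qp xa)/forces_allin/(_ y q (le_refl q) ya).
move=> /forces_allin/(_ z q (le_refl q) zb)/forces_imp/(_ q (le_refl q)).
by apply; split.
Qed.

Section Check.
Variable nu : cardinal.
Implicit Types (a b c : nu) (A : set nu).
Local Notation chk := (@check_ordinal P nu).

Lemma check_ordinalE a :
  chk a = check_family (fun y : {y : nu | clt y a} => chk (proj1_sig y)).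
Proof.
rewrite /check_ordinal Fix_eq // => x f g fg; congr check_family.
by apply/funext => y; rewrite fg.
Qed.

Lemma forces_mem_check_family p T (f : T -> name P) s :
  fo p (FMem s (check_family f)) <-> forall q, le q p -> exists2 r, le r q &
    exists i, fo r (FEq s (f i)).
Proof.
rewrite /check_family forces_mem_name; split=> H q qp; have [r rq] := H q qp.
  by move=> [[i r'] [_ /= Hi]]; exists r => //; exists i.
by move=> [i Hi]; exists r => //; exists (i, r).
Qed.

(** If [a < b], then [chk a] is forced to be a member of itself, so some condition makes it equal to
    a [chk c] with [c < a], against the induction hypothesis. The case [b < a] is similar. *)
Lemma forces_check_eq p a b : fo p (FEq (chk a) (chk b)) -> a = b.
Proof.
elim/(well_founded_ind (@clt_wf nu)): a b p => a IH b p ab.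
case: (clt_total a b) => [lt|[//|lt]].
  have : fo p (FMem (chk a) (chk b)).
    rewrite (check_ordinalE b).
    apply/forces_mem_check_family => q qp; exists q => //.
    by exists (exist _ a lt); exact: forces_eq_refl.
  move=> /(forces_mem_eqr (forces_eq_sym ab)); rewrite {2}(check_ordinalE a).
  move=> /forces_mem_check_family/(_ p (le_refl p))[r _ [[c ca] /= /forces_eq_sym/IH]].
  by move=> /(_ ca) e; rewrite e in ca; case: (wo_irr (wo_card nu) ca).
have : fo p (FMem (chk b) (chk a)).
  rewrite (check_ordinalE a).
  apply/forces_mem_check_family => q qp; exists q => //.
  by exists (exist _ b lt); exact: forces_eq_refl.
move=> /(forces_mem_eqr ab); rewrite {2}(check_ordinalE b).
move=> /forces_mem_check_family/(_ p (le_refl p))[r _ [[c cb] /= /IH-/(_ lt) e]].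
by rewrite -e in cb; case: (wo_irr (wo_card nu) cb).
Qed.

Lemma forces_mem_check_set p s A :
  fo p (FMem s (check_set P A)) <-> forall q, le q p -> exists2 r, le r q &
    exists2 a, A a & fo r (FEq s (chk a)).
Proof.
rewrite forces_mem_check_family; split=> H q qp; have [r rq] := H q qp.
  by move=> [[a Aa] Hi]; exists r => //; exists a.
by move=> [a Aa Hi]; exists r => //; exists (exist _ a Aa).
Qed.

Lemma forces_check_mem_set p a A : fo p (FMem (chk a) (check_set P A)) -> A a.
Proof.
by move=> /forces_mem_check_set/(_ p (le_refl p))[r _ [b Ab /forces_check_eq->]].
Qed.

End Check.

End ForcingRelation.

(** * Preservation of saturation *)

Section Preservation.
Variables (lambda : cardinal) (Z : Type) (I : set (set lambda)) (J : set (set Z)).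
Hypotheses (hI : is_ideal I) (hJ : is_ideal J).
Hypothesis lam_inf : infinite_set [set: lambda].

Local Notation P := (quot J setT).
Local Notation leP := (@quot_le Z J setT).
Local Notation fo := (forces leP).
Local Notation chk := (@check_ordinal P lambda).

Let lerefl := @quot_le_refl Z J hJ setT.
Let letrans := @quot_le_trans Z J hJ setT.

Definition sec (S : set (lambda * Z)) (x : lambda) : set Z := [set z | S (x, z)].

(* A set [S] names, in the extension by [J], the set of those [x] with [sec S x]
   in the generic filter; [prod_ideal] corresponds to forcing with [I] and then
   with the image of [J]. *)
Definition prod_ideal : set (set (lambda * Z)) := [set S | I [set x | ~ J (sec S x)]].

Lemma prod_idealP : is_ideal prod_ideal.
Proof.
split.
- apply: (idealS hI) (ideal0 hI) => x; apply; apply: (idealS hJ) (ideal0 hJ) => z.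
  by case.
- move=> S S' SS'; apply: (idealS hI) => x nS JS'; apply: nS.
  by apply: (idealS hJ) JS' => z /SS'.
- move=> S S' LS LS'; apply: (ideal_cover hI LS LS') => x nU.
  have [JS|] := pselect (J (sec S x)); last by left.
  by right=> JS'; apply: nU; apply: (ideal_cover hJ JS JS').
- move=> LT; apply: (idealT hI); apply: (idealS hI) LT => x _.
  exact: idealT.
Qed.

Definition sec_on S (q : P) := [set x | ~ J (sec S x `&` rep q)].

(** Combinatorial form of [p] forcing the set named by [S] to be positive for the ideal generated by
    [I]: [sec_on S q] consists of the points that [q] does not exclude from it. *)
Definition forces_positive S (p : P) := forall q, leP q p -> ~ I (sec_on S q).

Section Condition.
Variable nu : cardinal.
Hypotheses (lam_succ : is_succ_of nu lambda) (J_sat : saturated leP lambda).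
Hypotheses (I_fine : fine_ideal (@clt lambda) I) (I_normal : normal_ideal (@clt lambda) I).

(** Otherwise the positive sets [B] such that [sec S x] meets [B] positively only for a null set of
    [x] are dense. A maximal antichain of them has at most [nu] members, so for almost every [x] the
    section is almost disjoint from all of them; a positive such section contradicts maximality. *)
Lemma forces_positive_exists S : ~ prod_ideal S -> exists p, forces_positive S p.
Proof.
move=> Spos; apply: contrapT => /forallNP np.
have small p : exists2 q, leP q p & I (sec_on S q).
  by have /existsNP[q /not_implyP[qp /contrapT Iq]] := np p; exists q.
pose good (F : set (set Z)) :=
  (forall B, F B -> ~ J B /\ I [set x | ~ J (sec S x `&` B)]) /\
  (forall B B', F B -> F B' -> B <> B' -> J (B `&` B')).
have [F [[FI Fdisj] Fmax]] : exists F, good F /\ forall G, F `<` G -> ~ good G.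
  apply: Zorn_bigcup => C Cgood Ctot; split=> [B [F /Cgood[FI _] /FI]//|].
  move=> B B' [F CF FB] [F' CF' FB'] BB'.
  have [FF'|F'F] := Ctot _ _ CF CF'.
    by have [_ H] := Cgood _ CF'; apply: H => //; exact: FF'.
  by have [_ H] := Cgood _ CF; apply: H => //; exact: F'F.
have Fnu : F #<= [set: nu].
  apply: (lt_succ_le lam_succ); apply: (saturated_family_lt (A := id) hJ J_sat) => //.
  by move=> B /FI[].
have [c Fc] : exists c, F #<= seg (@clt lambda) c.
  have [[c nuc]|lnu] := card_compare nu lambda; first by exists c; exact: card_le_trans Fnu nuc.
  by case: lam_succ => -[].
have [e [ec einj]] := card_le_inj_on c Fc.
(* As [F] is coded below [c], the union of its exceptional sets is, beyond [c], a diagonal union,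
   null by normality. *)
pose N a := [set x | exists2 B, F B /\ e B = a & ~ J (sec S x `&` B)].
have IN a : I (N a).
  have [[B [FB eB]]|nB] := pselect (exists B, F B /\ e B = a); last first.
    by apply: (idealS hI) (ideal0 hI) => x [B FB]; case: nB; exists B.
  have [_] := FI _ FB; apply: (idealS hI) => x [B' [FB' eB']].
  by rewrite (einj B' B) // eB.
have [x Sx nx] := positive_ex hI Spos (idealU hI (I_fine c) (I_normal IN)).
have JB B : F B -> J (sec S x `&` B).
  move=> FB; apply: contrapT => nJ; apply: nx.
  have [cx|] := pselect (clt c x); last by left.
  right; exists (e B); split; first exact: clt_trans (ec _ FB) cx.
  by exists B.
have [q /(quot_le_cls hJ) qS Iq] := small (cls (@subsetT _ _) Sx).
pose B := rep q `&` sec S x.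
have Bpos : ~ J B.
  apply: (positive_cover hJ (rep_pos (p := q)) qS) => z qz.
  by have [Sz|nSz] := pselect (sec S x z); [right|left].
have nFB : ~ F B.
  by move=> /JB; apply: contra_not Bpos; apply: (idealS hJ) => z [qz Sz]; split.
apply: (Fmax (B |` F)).
  by split=> [B' FB'|BF]; [right|apply: nFB; apply: BF; left].
have BB' B' : F B' -> J (B `&` B').
  by move=> /JB; apply: (idealS hJ) => z [[_ Sz] B'z].
split=> [B' [->|/FI//]|B1 B2 [->|F1] [->|F2] // n12].
- split=> //; apply: (idealS hI) Iq => y nJ JS; apply: nJ.
  by apply: (idealS hJ) JS => z [Sz [qz _]].
- exact: BB'.
- by rewrite setIC; exact: BB'.
- exact: Fdisj.
Qed.

End Condition.

Lemma forces_positive_mono S p q : leP q p -> forces_positive S p -> forces_positive S q.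
Proof. by move=> qp H r rq; apply: H; exact: letrans rq qp. Qed.

(** * Names for subsets of lambda and for families of them *)

Definition set_name (S : set (lambda * Z)) : name P :=
  Name (fun i : {xp : lambda * P | J (rep xp.2 `\` sec S xp.1)} => chk (proj1_sig i).1)
       (fun i => (proj1_sig i).2).

Lemma forces_mem_set_name p t S : fo p (FMem t (set_name S)) <->
  forall q, leP q p -> exists2 r, leP r q &
    exists2 x, J (rep r `\` sec S x) & fo r (FEq t (chk x)).
Proof.
rewrite (forces_mem_name leP); split=> H q qp; have [r rq] := H q qp.
  move=> [[[x p'] /= Jx] [/(quot_leP hJ) rp' Hx]]; exists r => //; exists x => //.
  exact: (ideal_diff_trans hJ) rp' Jx.
move=> [x Jx Hx]; exists r => //.
by exists (exist (fun xp : lambda * P => J (rep xp.2 `\` sec S xp.1)) (x, r) Jx).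
Qed.

Lemma forces_check_mem_set_name p x S :
  fo p (FMem (chk x) (set_name S)) <-> J (rep p `\` sec S x).
Proof.
split=> [H|Jx]; last first.
  apply/forces_mem_set_name => q /(quot_leP hJ) qp; exists q => //; exists x.
    exact: (ideal_diff_trans hJ) qp Jx.
  exact: forces_eq_refl.
apply: contrapT => pos; pose q := cls (@subsetT _ _) pos.
have qp : leP q p by apply/(quot_cls_le hJ); apply: (idealS hJ) (ideal0 hJ) => z [[]].
move/forces_mem_set_name: H => /(_ q qp)[r /(quot_le_cls hJ) rq [y Jy]].
move=> /(forces_check_eq lerefl letrans) xy; rewrite -xy in Jy.
apply: (rep_pos (p := r)); apply: (ideal_cover hJ rq Jy) => z rz.
have [Sz|nSz] := pselect (sec S x z); last by right.
by left; split=> // -[].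
Qed.

(** Only conditions forcing [S] to be positive are attached to it, so that the name denotes a family
    of positive sets. *)
Definition family_name (F : set (set (lambda * Z))) : name P :=
  Name (fun i : {Sp : set (lambda * Z) * P | F Sp.1 /\ forces_positive Sp.1 Sp.2} =>
          set_name (proj1_sig i).1)
       (fun i => (proj1_sig i).2).

Lemma forces_mem_family_name p t F : fo p (FMem t (family_name F)) <->
  forall q, leP q p -> exists2 r, leP r q &
    exists2 S, F S /\ forces_positive S r & fo r (FEq t (set_name S)).
Proof.
rewrite (forces_mem_name leP); split=> H q qp; have [r rq] := H q qp.
  move=> [[[S p'] /= [FS Sp']] [rp' Hx]]; exists r => //; exists S => //.
  by split=> //; exact: forces_positive_mono Sp'.
move=> [S FSr Hx]; exists r => //.
by exists (exist (fun Sp : set (lambda * Z) * P => F Sp.1 /\ forces_positive Sp.1 Sp.2) (S, r) FSr).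
Qed.

Local Notation lam := (check_set P [set: lambda]).
Local Notation Inm := (check_set_of_sets P I).

Lemma forces_mem_check_ideal p t : fo p (FMem t Inm) <->
  forall q, leP q p -> exists2 r, leP r q & exists2 Y, I Y & fo r (FEq t (check_set P Y)).
Proof.
rewrite (forces_mem_check_family lerefl); split=> H q qp; have [r rq] := H q qp.
  by move=> [[Y IY] HY]; exists r => //; exists Y.
by move=> [Y IY HY]; exists r => //; exists (exist _ Y IY).
Qed.

Lemma set_name_sub p S : fo p (FSub (set_name S) lam).
Proof.
apply/(forces_sub lerefl letrans) => t q qp /forces_mem_set_name H.
apply/(forces_mem_check_set lerefl) => r rq.
have [r' r'r [x _ tx]] := H r rq.
by exists r' => //; exists x.
Qed.

(** If [r1] forces the set into some [Y] in [I], then [Y] includes [sec_on S r1]: when [sec S x]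
    meets [rep r1] positively, the intersection is a condition putting [x] into the set. *)
Lemma set_name_positive p S : forces_positive S p ->
  fo p (FNot (FInGenIdeal lam Inm (set_name S))).
Proof.
move=> Sp; apply/(forces_not leP) => q qp /(forces_in_gen_ideal leP)[_ /(_ q (lerefl q))].
move=> [r rq [y [/forces_mem_check_ideal/(_ r (lerefl r))[r1 r1r [Y IY yY]]]]].
move=> /(forces_sub lerefl letrans) Sy.
have r1p : leP r1 p by exact: letrans r1r (letrans rq qp).
apply: (Sp r1 r1p); apply: (idealS hI) IY => x nJ.
pose r2 := cls (@subsetT _ _) nJ.
have r21 : leP r2 r1 by apply/(quot_cls_le hJ); apply: (idealS hJ) (ideal0 hJ) => z [[]].
have : fo r2 (FMem (chk x) (set_name S)).
  apply/forces_check_mem_set_name; have [H _] := rep_cls hJ (@subsetT _ _) nJ.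
  by apply: (idealS hJ) H => z [rz nS]; split=> // -[].
move=> /(Sy _ _ (letrans r21 r1r)).
move=> /(forces_mem_eqr letrans (forces_mono letrans r21 yY)).
exact: forces_check_mem_set.
Qed.

Lemma forces_sub_eq p x y u : fo p (FEq x y) -> fo p (FSub y u) -> fo p (FSub x u).
Proof.
move=> xy /(forces_sub lerefl letrans) yu; apply/(forces_sub lerefl letrans) => t q qp tx.
apply: yu => //; apply: (forces_mem_eqr letrans) tx.
exact: forces_mono xy.
Qed.

Lemma forces_ingen_eq p x y : fo p (FEq x y) ->
  fo p (FInGenIdeal lam Inm y) -> fo p (FInGenIdeal lam Inm x).
Proof.
move=> xy /(forces_in_gen_ideal leP)[ylam H]; apply/(forces_in_gen_ideal leP).
split=> [|q qp]; first exact: forces_sub_eq ylam.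
have [r rq [Y [YI yY]]] := H q qp.
exists r => //; exists Y; split=> //; apply: forces_sub_eq yY.
apply: forces_mono xy => //; exact: letrans rq qp.
Qed.

Lemma family_name_antichain p F :
  (forall S S', F S -> F S' -> S <> S' -> prod_ideal (S `&` S')) ->
  fo p (FAntichainModGen lam Inm (family_name F)).
Proof.
move=> Fdisj; split.
  apply/(forces_allin lerefl letrans) => x q qp /forces_mem_family_name Hx.
  apply: (forces_dense lerefl letrans) => r rq.
  have [r1 r1r [S [FS Sr1] xS]] := Hx r rq; exists r1 => //; split.
    by apply: forces_sub_eq xS _; exact: set_name_sub.
  apply/(forces_not leP) => r2 r21 xI.
  have /(forces_not leP)/(_ r2 r21) := set_name_positive Sr1; apply.
  apply: forces_ingen_eq xI; apply: (forces_eq_sym).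
  exact: forces_mono xS.
apply/(forces_allin lerefl letrans) => x q qp /forces_mem_family_name Hx.
apply/(forces_allin lerefl letrans) => y q1 q1q /forces_mem_family_name Hy.
apply/(forces_imp lerefl letrans) => q2 q21 /(forces_not leP) nxy z.
change (fo q2 (FImp (FIsInter z x y) (FInGenIdeal lam Inm z))).
apply/(forces_imp lerefl letrans) => q3 q32 zxy.
apply: (forces_dense lerefl letrans) => r rq3.
have rq2 := letrans rq3 q32; have rq1 := letrans rq2 q21.
have [r1 r1r [S [FS _] xS]] := Hx r (letrans rq1 q1q).
have [r2 r21 [S' [FS' _] yS']] := Hy r1 (letrans r1r rq1).
have {}xS : fo r2 (FEq x (set_name S)) by exact: forces_mono xS.
have SS' : S <> S'.
  move=> SS'; apply: (nxy r2); first exact: letrans r21 (letrans r1r rq2).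
  by apply: (forces_eq_trans letrans xS); rewrite SS'; exact: forces_eq_sym.
have r2q3 : leP r2 q3 by exact: letrans r21 (letrans r1r rq3).
have zP t q' : leP q' r2 -> fo q' (FMem t z) ->
    fo q' (FMem t (set_name S)) /\ fo q' (FMem t (set_name S')).
  move=> q'r2 tz.
  have /(forces_iff lerefl letrans) Ht :
    fo q3 (FIff (FMem t z) (FAnd (FMem t x) (FMem t y))) := zxy t.
  have [tx ty] := (Ht q' (letrans q'r2 r2q3)).1 tz.
  by split; [apply: (forces_mem_eqr letrans) tx|apply: (forces_mem_eqr letrans) ty];
    apply: forces_mono q'r2 _.
exists r2; first exact: letrans r21 r1r.
apply/(forces_in_gen_ideal leP); split.
  apply/(forces_sub lerefl letrans) => t q' q'r2 /(zP _ _ q'r2)[tS _].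
  exact: ((forces_sub lerefl letrans _ _ _).1 (@set_name_sub q' S) t q' (lerefl q') tS).
(* A condition putting [a] into both sets is almost included in both sections at [a], whence [a] is
   in [Y]. *)
pose Y := [set a | ~ J (sec (S `&` S') a)].
have IY : I Y by exact: Fdisj.
move=> q' q'r2; exists q' => //; exists (check_set P Y); split.
  apply/forces_mem_check_ideal => q'' _; exists q'' => //; exists Y => //.
  exact: forces_eq_refl.
apply/(forces_sub lerefl letrans) => t q4 q4q' /(zP _ _ (letrans q4q' q'r2))[].
move=> /forces_mem_set_name tS tS'; apply/(forces_mem_check_set lerefl) => q5 q54.
have [q6 q65 [a Ja ta]] := tS q5 q54; exists q6 => //; exists a => //.
have {}tS' : fo q6 (FMem t (set_name S')).
  apply: forces_mono tS' => //; exact: letrans q65 q54.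
have /forces_check_mem_set_name Ja' := forces_mem_eql letrans ta tS'.
move=> JSS'; apply: (rep_pos (p := q6)).
apply: (ideal_cover hJ (idealU hJ Ja Ja') JSS') => z' qz'.
have [Sz|nSz] := pselect (sec S a z'); last by left; left.
by have [Sz'|nSz'] := pselect (sec S' a z'); [right|left; right].
Qed.

(** In the extension the family injects into [lambda]. Each [S] gets a triple [(a, b, c)]: [d a]
    fixes a name for the injection, and [d b] below it forces [S] positive with value [c]. Then
    [d b] forces two sets with the same triple to be equal, which almost disjoint ones cannot be. *)
Lemma preserved_prod_saturated (d : lambda -> P) (F : set (set (lambda * Z))) :
  (forall p, exists a, leP (d a) p) ->
  forced leP (FGenIdealSuccSaturated lam Inm) ->
  (forall S, F S -> exists p, forces_positive S p) ->
  (forall S S', F S -> F S' -> S <> S' -> prod_ideal (S `&` S')) ->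
  F #<= [set: lambda].
Proof.
move=> d_dense pres Fpos Fdisj.
have card_le p : fo p (FCardLe (family_name F) lam).
  have /(forces_imp lerefl letrans)/(_ p (lerefl p)) : fo p (FImp
    (FAntichainModGen lam Inm (family_name F)) (FCardLe (family_name F) lam)).
    exact: (pres p).
  by apply; exact: family_name_antichain.
have [c0 _] := infinite_setN0 lam_inf.
(* The name [f a] depends on [a] alone, so sets sharing [a] are compared under one injection; [lam]
   is a dummy value. *)
have /choice[f fP] a : exists f, (exists g, fo (d a) (FInjection g (family_name F) lam)) ->
    fo (d a) (FInjection f (family_name F) lam).
  have [[g gP]|ng] := pselect (exists g, fo (d a) (FInjection g (family_name F) lam)).
    by exists g.
  by exists lam.
pose value S (k : lambda * lambda * lambda) (y : name P) :=
  let: (a, b, c) := k in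
  [/\ forces_positive S (d b), leP (d b) (d a),
      fo (d a) (FInjection (f a) (family_name F) lam), fo (d b) (FEq y (chk c))
    & fo (d b) (FPairIn (set_name S) y (f a))].
have mem_family S q : F S -> forces_positive S q ->
    fo q (FMem (set_name S) (family_name F)).
  move=> FS Sq; apply/forces_mem_family_name => r rq; exists r => //; exists S.
    by split=> //; exact: forces_positive_mono Sq.
  exact: forces_eq_refl.
have valueP S : exists k, F S -> exists y, value S k y.
  have [FS|] := pselect (F S); last by exists (c0, c0, c0).
  have [p Sp] := Fpos S FS.
  have /(forces_ex leP)/(_ p (lerefl p))[r rp [g gP]] := card_le p.
  have [a ar] := d_dense r.
  have fa : fo (d a) (FInjection (f a) (family_name F) lam).
    by apply: fP; exists g; apply: forces_mono gP.
  have [tot _] := forces_injection lerefl letrans fa.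
  have Sa : forces_positive S (d a) by apply: forces_positive_mono Sp; exact: letrans ar rp.
  have [r1 r1a [y [yl yf]]] := tot _ _ (lerefl _) (mem_family _ _ FS Sa).
  move/(forces_mem_check_set lerefl)/(_ _ (lerefl _)): yl => [r2 r21 [c _ yc]].
  have [b br2] := d_dense r2.
  exists (a, b, c) => _; exists y; split=> //.
  - by apply: forces_positive_mono Sa; exact: letrans br2 (letrans r21 r1a).
  - exact: letrans br2 (letrans r21 r1a).
  - exact: forces_mono yc.
  - by apply: forces_mono yf => //; exact: letrans br2 r21.
have [k kP] := choice valueP.
apply: (@card_le_trans _ _ _ [set: lambda * lambda * lambda]); last first.
  rewrite -(@setXTT (lambda * lambda)).
  apply: card_le_trans (card_leX (cardinal_square lam_inf) (card_lexx _)) _.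
  by rewrite setXTT; exact: cardinal_square.
apply: (@inj_on_card_le _ _ _ _ k) => // S S' FS FS' kSS'.
have [y] := kP S FS; have [y'] := kP S' FS'; rewrite -kSS'.
case: (k S) => [[a b] c] [S'b _ _ y'c y'f] [Sb ba fa yc yf].
apply: contrapT => SS'; have := Fdisj _ _ FS FS' SS'.
have {}y'f : fo (d b) (FPairIn (set_name S') y (f a)).
  apply: (forces_pairin_eq lerefl letrans) y'f; apply: (forces_eq_trans letrans y'c).
  exact: forces_eq_sym.
have ylam : fo (d b) (FMem y lam).
  by apply/(forces_mem_check_set lerefl) => q qb; exists q => //; exists c => //;
     apply: forces_mono yc.
have [_ inj] := forces_injection lerefl letrans fa.
have eqS := inj _ _ _ _ ba (mem_family _ _ FS Sb) (mem_family _ _ FS' S'b) ylam yf y'f.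
(* It suffices that [sec_on S (d b)] lies in the null set of those [x] where [S] and [S'] have a
   positive common section. Elsewhere the condition [r] below would put [x] into both sets. *)
apply: contra_not (Sb _ (lerefl _)); apply: (idealS hI) => x nJ JSS'.
pose r := cls (@subsetT _ _) nJ.
have rb : leP r (d b) by apply/(quot_cls_le hJ); apply: (idealS hJ) (ideal0 hJ) => z [[]].
have [rS Sr] := rep_cls hJ (@subsetT _ _) nJ.
have : fo r (FMem (chk x) (set_name S)).
  by apply/forces_check_mem_set_name; apply: (idealS hJ) rS => z [rz nS]; split=> // -[].
move=> /(forces_mem_eqr letrans (forces_mono letrans rb eqS)).
move=> /forces_check_mem_set_name rS'; apply: (nJ).
apply: (ideal_cover hJ (idealU hJ Sr rS') JSS') => z [Sz bz].
have [rz|nrz] := pselect (rep r z); last by left; left; split=> // -[].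
by have [S'z|nS'z] := pselect (sec S' x z); [right|left; right].
Qed.

End Preservation.

(** * The successor case *)

Section SuccessorCase.
Variables (lambda nu kappa : cardinal).
Local Notation Z := (subsets_ot lambda kappa).
Variables (I : set (set kappa)) (J : set (set Z)).
Hypotheses (hI : is_ideal I) (hJ : is_ideal J).
Hypotheses (I_fine : fine_ideal (@clt kappa) I) (J_fine : fine_ideal (@mem_ot lambda kappa) J).
Hypothesis I_normal : normal_ideal (@clt kappa) I.
Hypothesis J_normal : normal_ideal (@mem_ot lambda kappa) J.
Variables (D : kappa -> set kappa) (D_dense : dense_family I D).

Local Notation L := (iter_ideal I J).
Local Notation T := (trace_ideal I J).
Local Notation K := (prod_ideal T J).

(** The part of [S] over points with positive section is null because these points form a set in
    [T]; the rest is null by normality of [J]. *)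
Lemma prod_sub_iter : K `<=` L.
Proof.
move=> S KS; have hL := iter_idealP hI hJ.
pose A x := [set z | S (x, z) /\ J (sec S x)].
have JA x : J (A x).
  have [JS|nJS] := pselect (J (sec S x)); first by apply: (idealS hJ) JS => z [].
  by apply: (idealS hJ) (ideal0 hJ) => z [].
have LA : L [set w | A w.1 w.2].
  apply: (idealS hJ) (J_normal JA) => z nI; apply: contrapT => nz; apply: nI.
  apply: (idealS hI) (ideal0 hI) => a Aa; apply: nz; exists (enum_ot z a).
  by split=> //; exact: mem_enum_ot.
apply: (ideal_cover hL KS LA) => -[x z] Sw.
by have [JS|nJS] := pselect (J (sec S x)); [right|left].
Qed.

(* If [K] is saturated, [L] is a restriction of it: the diagonal union of a
   maximal [K]-antichain in [L] is the largest element of [L] modulo [K]. *)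
Lemma iter_eq_prod_restr :
  (forall F : set (set (lambda * Z)), (forall S, F S -> ~ K S) ->
    (forall S S', F S -> F S' -> S <> S' -> K (S `&` S')) -> F #<= [set: lambda]) ->
  exists2 B, L B & forall S, L S -> K (S `\` B).
Proof.
move=> satK; have hL := iter_idealP hI hJ.
have hT := trace_idealP hI hJ; have hK := prod_idealP hT hJ.
pose good (F : set (set (lambda * Z))) := (forall S, F S -> ~ K S /\ L S) /\
  (forall S S', F S -> F S' -> S <> S' -> K (S `&` S')).
have [F [[FL Fdisj] Fmax]] : exists F, good F /\ forall G, F `<` G -> ~ good G.
  apply: Zorn_bigcup => C Cgood Ctot; split=> [S [F /Cgood[FI _] /FI]//|].
  move=> S S' [F CF FS] [F' CF' FS'] SS'.
  have [FF'|F'F] := Ctot _ _ CF CF'.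
    by have [_ H] := Cgood _ CF'; apply: H => //; exact: FF'.
  by have [_ H] := Cgood _ CF; apply: H => //; exact: F'F.
have [e eF] : exists e : lambda -> set (lambda * Z), forall S, F S -> exists c, e c = S.
  by apply: (card_le_surj set0); apply: satK => // S /FL[].
pose R c : set (lambda * Z) := [set w | F (e c) /\ e c w].
have LR c : L (R c).
  have [Fc|nFc] := pselect (F (e c)).
    by have [_] := FL _ Fc; apply: (idealS hL) => w [].
  by apply: (idealS hL) (ideal0 hL) => w [].
exists [set w | exists c, [/\ clt c w.1, mem_ot c w.2 & R c w]].
  exact: iter_ideal_diag.
move=> S LS; set B := [set w | _]; apply: contrapT => SBpos.
have LSB : L (S `\` B) by apply: (idealS hL) LS => w [].
(* For every [x] beyond [c], almost every [z] contains [c], and then membership in [R c] gives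
   membership in [B]. *)
have RB c : K (R c `\` B).
  apply: (idealS hT) (trace_fine hI hJ I_fine J_fine c) => x nJ cx; apply: nJ.
  apply: (idealS hJ) (J_fine c) => z [Rc nB] cz; apply: nB.
  by exists c.
have disj S' : F S' -> K ((S `\` B) `&` S').
  move=> FS'; have [c ec] := eF _ FS'; apply: (idealS hK) (RB c) => w [[_ nB] S'w].
  by split=> //; split; rewrite ec.
have nF : ~ F (S `\` B) by move=> /disj; rewrite setIid.
apply: (Fmax ((S `\` B) |` F)).
  by split=> [S' FS'|SF]; [right|apply: nF; apply: SF; left].
split=> [S' [->|/FL]//|S1 S2 [->|F1] [->|F2] // n12].
- exact: disj.
- by rewrite setIC; exact: disj.
- exact: Fdisj.
Qed.

(** Below the section at [x] of the complement of [B], the fewer than [lambda] sections of the sets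
    [R c] with [c < x] are not dense, by uniform density. So some positive [C x] almost includes
    none of the positive ones. The set with sections [C x] is then [L]-positive but almost includes
    no [R c]. *)
Lemma uniform_density_false (B : set (lambda * Z)) (R : lambda -> set (lambda * Z)) :
  infinite_set [set: lambda] ->
  uniform_density J lambda -> L B -> (forall S, L S -> K (S `\` B)) ->
  dense_family L R -> False.
Proof.
move=> lam_inf unif LB LK [Rpos Rdense]; have hL := iter_idealP hI hJ.
have hT := trace_idealP hI hJ; have hK := prod_idealP hT hJ.
pose R' c := R c `\` B.
have /choice[C CP] x : exists C, C `<=` sec (~` B) x /\ (~ J (sec (~` B) x) ->
    ~ J C /\ forall c, clt c x -> ~ J (sec (R' c) x) -> ~ J (sec (R' c) x `\` C)).
  have [JB|Bpos] := pselect (J (sec (~` B) x)); first by exists set0; split.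
  have R'B c : sec (R' c) x `<=` sec (~` B) x by move=> z [].
  (* When the section of [R' c] is null, the class of the whole section is a dummy value. *)
  pose q c := if pselect (J (sec (R' c) x)) is right n then cls (@R'B c) n
              else cls (fun z => id) Bpos.
  have [_ /(_ (q @` seg (@clt lambda) x)) qdense] := unif _ Bpos.
  have /existsNP[p np] : ~ dense_subset (@quot_le _ J (sec (~` B) x)) (q @` seg (@clt lambda) x).
    move=> /qdense lamq; apply: (@seg_lt lambda x).
    exact: card_le_trans lamq (card_image_le _ _).
  exists (rep p); split=> [|_]; first exact: rep_sub.
  split=> [|c cx npos Jp]; first exact: rep_pos.
  apply: np; exists (q c); first by exists c.
  rewrite /q; case: (pselect (J (sec (R' c) x))) => // n.
  exact/quot_cls_le.
pose S : set (lambda * Z) := [set w | C w.1 w.2].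
have BnK : ~ K (~` B).
  move=> /prod_sub_iter LnB; apply: (idealT hL).
  by apply: (ideal_cover hL LB LnB) => w _; have [|] := pselect (B w); [left|right].
have Spos : ~ L S.
  move=> /LK KS; apply: BnK; apply: (idealS hT) KS => x nB JS.
  have [CB /(_ nB)[nC _]] := CP x; apply: nC.
  by apply: (idealS hJ) JS => z Cz; split=> //; exact: CB.
have [c RS] := Rdense _ Spos.
have R'pos : ~ K (R' c).
  move=> /prod_sub_iter LR'; apply: (Rpos c); apply: (ideal_cover hL LB LR') => w Rw.
  by have [|] := pselect (B w); [left|right].
(* This yields an [x] beyond [c] where the section of [R' c] is positive and almost included in
   [C x], against the choice of [C x]. *)
have := positive_ex hT R'pos (idealU hT (LK _ RS) (trace_fine hI hJ I_fine J_fine c)).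
move=> [x nR' /not_orP[/contrapT JRS /contrapT cx]].
have [|CB] := pselect (J (sec (~` B) x)).
  by move=> JB; apply: nR'; apply: (idealS hJ) JB => z [].
have [_ /(_ CB)[_ /(_ c cx nR')]] := CP x; apply.
by apply: (idealS hJ) JRS => z [[Rz nB] nC]; split.
Qed.

Lemma successor_false : infinite_set [set: nu] -> is_succ_of nu lambda ->
  saturated (@quot_le _ J setT) lambda -> uniform_density J lambda ->
  preserves_succ_saturated_ideals (@quot_le _ J setT) lambda -> False.
Proof.
move=> nu_inf lamS sat unif pres.
have hT := trace_idealP hI hJ; have hL := iter_idealP hI hJ.
have lam_inf : infinite_set [set: lambda].
  by case: lamS => -[nulam _] _ fin; apply: nu_inf; exact: card_le_finite nulam fin.
have [Q Qdense Qlam] := (unif _ (idealT hJ)).1.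
have [|d dQ] := @card_le_surj lambda _ Q (cls (fun z => id) (idealT hJ)).
  by move: Qlam; rewrite card_eq_le => /andP[].
have d_dense p : exists a, quot_le (d a) p.
  by have [q /dQ[a <-]] := Qdense p; exists a.
have [E Edense] : exists E : lambda -> set Z, dense_family J E.
  apply: (dense_le_family hJ); exists Q => //.
  by move: Qlam; rewrite card_eq_le => /andP[].
have [R Rdense] := iter_ideal_dense_family hI hJ J_fine J_normal D_dense lam_inf Edense.
have T_fine := trace_fine hI hJ I_fine J_fine.
have T_normal := trace_normal hI hJ J_fine I_normal J_normal.
(* Cylinders over an antichain modulo [T] form an antichain modulo [L], whose size the dense family
   [R] bounds. *)
have T_sat : succ_saturated (@quot_le _ T setT) lambda.
  apply: (succ_saturated_antichain_le hT) => F Fpos Fdisj.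
  by apply: (family_antichain_le (A := fun X => [set w | X w.1]) hL Rdense).
(* The saturation of [K] required here comes from the preservation hypothesis, applied to the ideal
   [T]. *)
have [F Fpos Fdisj|B LB LK] := iter_eq_prod_restr; last first.
  exact: uniform_density_false lam_inf unif LB LK Rdense.
apply: (preserved_prod_saturated hT hJ lam_inf d_dense) => //.
  exact: pres.
move=> S /Fpos; exact: (forces_positive_exists hT hJ lamS sat).
Qed.

End SuccessorCase.

Theorem theorem1 (kappa : cardinal) (hkappa : successor_cardinal kappa)
  (hI : exists I : set (set kappa),
     [/\ is_ideal I, fine_ideal (@clt kappa) I, complete_ideal kappa I
       & dense_le (@quot_le kappa I setT) kappa]) :
  ~ (exists (lambda : cardinal) (J : set (set (subsets_ot lambda kappa))),
      (weakly_inaccessible lambda /\ cardinal_lt kappa lambda) /\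
      [/\ is_ideal J, fine_ideal (@mem_ot lambda kappa) J,
          normal_ideal (@mem_ot lambda kappa) J, complete_ideal kappa J
        & succ_saturated (@quot_le _ J setT) lambda])
  /\
  ~ (exists (lambda : cardinal) (J : set (set (subsets_ot lambda kappa))),
      (successor_cardinal lambda /\ cardinal_lt kappa lambda) /\
      [/\ is_ideal J, fine_ideal (@mem_ot lambda kappa) J,
          normal_ideal (@mem_ot lambda kappa) J, complete_ideal kappa J
        & saturated (@quot_le _ J setT) lambda] /\
      uniform_density J lambda /\
      preserves_succ_saturated_ideals (@quot_le _ J setT) lambda).
Proof.
case: hkappa => mu [mu_inf kS].
case: hI => I0 [hI0 I0_fine I0_comp /(dense_le_family hI0)[D0 D0_dense]].
have [I [[I_ideal I_fine I_comp I_normal] [D D_dense]]] :=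
  normal_dense_ideal_exists mu_inf kS hI0 I0_fine I0_comp D0_dense.
split=> -[lambda [J]].
  move=> [[lamW klam] [J_ideal J_fine J_normal J_comp J_sat]].
  exact: (weakly_inaccessible_false I_ideal J_ideal I_fine J_fine I_comp J_comp
            J_normal D_dense mu_inf kS lamW klam J_sat).
move=> [[[nu [nu_inf lamS]] _] [[J_ideal J_fine J_normal _ J_sat] [unif pres]]].
exact: (successor_false I_ideal J_ideal I_fine J_fine I_normal J_normal D_dense
          nu_inf lamS J_sat unif pres).
Qed.
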